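(* Let $(\nabla,\nabla^* )$ be the primal and dual connections on $G$ induced by the $c$-divergence $\mathbf D$, let $\bar\nabla$ be the Levi-Civita connection of the pseudo-Riemannian metric $h$ on $M\times M'$, and let $\bar\nabla^{\pi_0},\bar\nabla^{\pi_1}$ be the connections on $G$ induced from $\bar\nabla$ by the projections $\pi_0(p,q')=(p,f(p))$ and $\pi_1(p,q')=(f^{-1}(q'),q')$ (all as defined in the context). Then $$\nabla=\bar\nabla^{\pi_0}\qquad\text{and}\qquad \nabla^*=\bar\nabla^{\pi_1}.$$
   Context: Setting. $M,M'$ are $n$-dimensional smooth manifolds ($n\ge 2$), and $c:M\times M'\to\mathbb R$ is a smooth cost function. In local coordinates $\xi=(\xi^1,\dots,\xi^n)$ on $M$ and $\eta'=(\eta'^{\bar 1},\dots,\eta'^{\bar n})$ on $M'$ write $c_{i:\bar j}=\frac{\partial^2 c}{\partial\xi^i\partial\eta'^{\bar j}}$. The cost is assumed non-degenerate: the matrix $(c_{i:\bar j})$ is invertible at every point. Einstein summation is used. Optimal transport map. $\varphi:M\to\mathbb R$ is smooth and $c$-concave, i.e. there is $\psi:M'\to\mathbb R\cup\{-\infty\}$ with $\varphi(p)=\inf_{q'\in M'}(c(p,q')-\psi(q'))$ for all $p\in M$. For each $p\in M$ there is a unique $q'=:D^c\varphi(p)\in M'$ with $\varphi(p)+\psi(q')=c(p,q')$, and $f=D^c\varphi$ is a smooth diffeomorphism from $M$ onto its range $f(M)\subset M'$. $\psi$ is the $c$-transform of $\varphi$: $\psi(q)=\inf_{p\in M}(c(p,q)-\varphi(p))$,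 so $\psi(q)=c(f^{-1}(q),q)-\varphi(f^{-1}(q))$ for $q\in f(M)$. The graph $G=\{(p,f(p)):p\in M\}$ is an $n$-dimensional embedded submanifold of $M\times M'$. $c$-divergence and dualistic structure. For $x=(p,q),\,x'=(p',q')\in G$, $\mathbf D[x:x']=c(p,q')-\varphi(p)-\psi(q')$. Using coordinates $\xi$ on $G$ via $(p,f(p))\mapsto p$ and writing $\mathbf D=\mathbf D[\xi:\xi']$, define $g_{ij}(\xi)=-\frac{\partial}{\partial\xi^i}\frac{\partial}{\partial\xi'^j}\mathbf D\big|_{\xi'=\xi}$ (a Riemannian metric on $G$), $\Gamma_{ijk}(\xi)=-\frac{\partial^2}{\partial\xi^i\partial\xi^j}\frac{\partial}{\partial\xi'^k}\mathbf D\big|_{\xi'=\xi}$, $\Gamma^*_{ijk}(\xi)=-\frac{\partial^2}{\partial\xi'^i\partial\xi'^j}\frac{\partial}{\partial\xi^k}\mathbf D\big|_{\xi'=\xi}$. The torsion-free connections $\nabla,\nabla^*$ have Christoffel symbols $\Gamma_{ij}{}^k=\Gamma_{ijm}g^{mk}$ and $\Gamma^*_{ij}{}^k=\Gamma^*_{ijm}g^{mk}$, with $\nabla_{\partial_i}\partial_j=\Gamma_{ij}{}^k\partial_k$ (similarly for $\nabla^*$). Pseudo-Riemannian metric $h$ on $M\times M'$. For $v=a^i\frac{\partial}{\partial\xi^i}+b^{\bar i}\frac{\partial}{\partial\eta'^{\bar i}}$ at $(\xi,\eta')$, $h(v,v)=-c_{i:\bar j}(\xi,\eta')a^ib^{\bar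 j}$, extended by polarization. Projections and induced connections. $\pi_0,\pi_1:M\times f(M)\to G$ are given by $\pi_0(p,q')=(p,f(p))$ and $\pi_1(p,q')=(f^{-1}(q'),q')$. For $\pi\in\{\pi_0,\pi_1\}$ and vector fields $X,Y$ on $G$, and $x\in G$, extend $X,Y$ to vector fields $\tilde X,\tilde Y$ on a neighborhood of $x$ in $M\times M'$ and set $\bar\nabla^\pi_XY|_x:=\pi_*(\bar\nabla_{\tilde X}\tilde Y|_x)\in T_xG$, where $\pi_*$ is the differential of $\pi$; this does not depend on the extensions and defines a torsion-free affine connection on $G$. *)

(* Defs.v *)
From HB Require Import structures.
From mathcomp Require Import all_boot all_order all_algebra.
From mathcomp Require Import all_classical all_reals all_analysis.
Set Implicit Arguments.
Unset Strict Implicit.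
Unset Printing Implicit Defensive.
Import Order.TTheory GRing.Theory Num.Theory.
Import numFieldNormedType.Exports.
Local Open Scope classical_set_scope.
Local Open Scope ring_scope.

Section smooth.
Context {R : realType} {V W : normedModType R}.

(* Meant for an open set U.  'D_v g is unspecified where g is not
   differentiable, but only its values on U are ever constrained. *)
Fixpoint Ck (k : nat) (U : set V) (g : V -> W) : Prop :=
  match k with
  | 0 => forall x, U x -> {for x, continuous g}
  | k'.+1 => (forall x, U x -> differentiable g x) /\
             (forall v : V, Ck k' U ('D_v g))
  end.

Definition smooth (U : set V) (g : V -> W) : Prop := forall k, Ck k U g.
End smooth.

Definition partial (R : realType) (d : nat) (i : 'I_d) (g : 'rV[R]_d -> R)
  : 'rV[R]_d -> R := 'D_(delta_mx 0 i) g.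

(* [coord a] is meaningful on [dom a] only, and [param a], its inverse, on
   [coord a @` dom a] only.  The record is pure data; the axioms are in
   [smooth_manifold].  The smooth structure is given by an arbitrary, not
   necessarily maximal, smooth atlas. *)
Record atlas (R : realType) (d : nat) (T : topologicalType) := Atlas {
  chart : Type;
  dom : chart -> set T;
  coord : chart -> T -> 'rV[R]_d;
  param : chart -> 'rV[R]_d -> T
}.

Section manifold.
Context {R : realType} {d : nat} {T : topologicalType}.
Implicit Type A : atlas R d T.

Definition smooth_atlas A : Prop :=
  (forall p, exists a, dom (a := A) a p) /\
  (forall a : chart A,
    [/\ open (dom a),
        open (coord a @` dom a),
        (forall p, dom a p -> param a (coord a p) = p),
        (forall p, dom a p -> {for p, continuous (coord a)}) &
        (forall u, (coord a @` dom a) u -> {for u, continuous (param a)})]) /\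
  (forall a b : chart A,
    smooth (coord a @` (dom a `&` dom b)) (coord b \o param a)).

Definition smooth_manifold A : Prop :=
  [/\ hausdorff_space T, @second_countable T & smooth_atlas A].

Definition smooth_fun A (U : set T) (g : T -> R) : Prop :=
  forall a : chart A, smooth (coord a @` (U `&` dom a)) (g \o param a).

(* A vector field is the family of its components in the charts; the value in
   chart [a] at [p] is meaningful only when [p] lies in [dom a]. *)
Definition vfield A := chart A -> T -> 'rV[R]_d.
End manifold.

Section maps.
Context {R : realType} {d1 d2 : nat} {T1 T2 : topologicalType}.
Variables (A1 : atlas R d1 T1) (A2 : atlas R d2 T2).

Definition smooth_map (U : set T1) (F : T1 -> T2) : Prop :=
  (forall p, U p -> {for p, continuous F}) /\
  (forall (a : chart A1) (b : chart A2),
    smooth (coord a @` (U `&` dom a `&` F @^-1` dom b))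
           (coord b \o F \o param a)).

(* The differential of F at p, from components in [a] to components in [b]. *)
Definition pushforward (F : T1 -> T2) (a : chart A1) (b : chart A2) (p : T1)
    (v : 'rV[R]_d1) : 'rV[R]_d2 :=
  'd (coord b \o F \o param a) (coord a p) v.

Definition prod_atlas : atlas R (d1 + d2) (T1 * T2)%type :=
  @Atlas R (d1 + d2) (T1 * T2)%type (chart A1 * chart A2)%type
    (fun ab => dom ab.1 `*` dom ab.2)
    (fun ab x => row_mx (coord ab.1 x.1) (coord ab.2 x.2))
    (fun ab u => (param ab.1 (lsubmx u), param ab.2 (rsubmx u))).

Definition graph_set (f : T1 -> T2) : set (T1 * T2)%type :=
  [set x | f x.1 = x.2].

Definition graph_point (f : T1 -> T2) (p : T1) : graph_set f :=
  exist _ (p, f p) (mem_set (erefl : graph_set f (p, f p))).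

Definition graph_atlas (f : T1 -> T2) : atlas R d1 (graph_set f) :=
  @Atlas R d1 (graph_set f) (chart A1)
    (fun a x => dom a (set_val x).1)
    (fun a x => coord a (set_val x).1)
    (fun a u => graph_point f (param a u)).
End maps.

Section connections.
Context {R : realType} {d : nat} {T : topologicalType}.
Variable A : atlas R d T.
Implicit Types (X Y Z : vfield A) (U : set T).

Definition vector_field U X : Prop :=
  (forall a b p, U p -> dom a p -> dom b p ->
     X b p = pushforward idfun a b p (X a p)) /\
  (forall a, smooth (coord a @` (U `&` dom a)) (X a \o param a)).

Definition vf_eq U X Y : Prop :=
  forall a p, U p -> dom a p -> X a p = Y a p.

Definition vf_add X Y : vfield A := fun a p => X a p + Y a p.
Definition vf_scale (g : T -> R) X : vfield A := fun a p => g p *: X a p.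

(* The derivative X(g); [g] may depend on the chart, so that [dir] also
   differentiates the components of a vector field. *)
Definition dir {W : normedModType R} X (g : chart A -> T -> W)
    (a : chart A) (p : T) : W :=
  'd (g a \o param a) (coord a p) (X a p).

Definition lie_bracket X Y : vfield A := fun a p => dir X Y a p - dir Y X a p.

(* A connection acts on the vector fields of every open subset, compatibly
   with restriction. *)
Definition affine_connection (nab : vfield A -> vfield A -> vfield A) : Prop :=
  forall U, open U ->
  [/\ (forall X Y, vector_field U X -> vector_field U Y ->
         vector_field U (nab X Y)),
      (forall X X' Y Y', vector_field U X -> vector_field U X' ->
         vector_field U Y -> vector_field U Y' ->
         vf_eq U X X' -> vf_eq U Y Y' -> vf_eq U (nab X Y) (nab X' Y')),
      (forall g X X' Y, smooth_fun A U g -> vector_field U X ->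
         vector_field U X' -> vector_field U Y ->
         vf_eq U (nab (vf_add (vf_scale g X) X') Y)
                 (vf_add (vf_scale g (nab X Y)) (nab X' Y))),
      (forall X Y Y', vector_field U X -> vector_field U Y ->
         vector_field U Y' ->
         vf_eq U (nab X (vf_add Y Y')) (vf_add (nab X Y) (nab X Y'))) &
      (forall g X Y, smooth_fun A U g -> vector_field U X ->
         vector_field U Y ->
         vf_eq U (nab X (vf_scale g Y))
                 (vf_add (fun a p => dir X (fun=> g) a p *: Y a p)
                         (vf_scale g (nab X Y))))].

Definition bilinear_field := chart A -> T -> 'rV[R]_d -> 'rV[R]_d -> R.

Definition levi_civita (h : bilinear_field)
    (nab : vfield A -> vfield A -> vfield A) : Prop :=
  [/\ affine_connection nab,
      (forall U X Y, open U -> vector_field U X -> vector_field U Y ->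
         vf_eq U (fun a p => nab X Y a p - nab Y X a p) (lie_bracket X Y)) &
      (forall U X Y Z, open U -> vector_field U X -> vector_field U Y ->
         vector_field U Z -> forall a p, U p -> dom a p ->
         dir (W := R^o) X (fun b q => h b q (Y b q) (Z b q)) a p =
         h a p (nab X Y a p) (Z a p) + h a p (Y a p) (nab X Z a p))].

(* [Gamma a u i j k] is the symbol with upper index k at the point of
   coordinates u in the chart [a]. *)
Definition connection_of_christoffel
    (Gamma : chart A -> 'rV[R]_d -> 'I_d -> 'I_d -> 'I_d -> R)
    (X Y : vfield A) : vfield A :=
  fun a p => \row_k \sum_i X a p 0 i *
    (partial i (fun u => Y a (param a u) 0 k) (coord a p) +
     \sum_j Gamma a (coord a p) i j k * Y a p 0 j).
End connections.

Section induced.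
Context {R : realType} {d e : nat} {T : topologicalType} {S : set T}.
Variables (AS : atlas R d S) (A : atlas R e T).

(* [Xt], defined on the open set [W] of the ambient manifold, extends [X],
   defined on the open set [V] of the submanifold. *)
Definition vf_extends (V : set S) (W : set T) (X : vfield AS) (Xt : vfield A)
  : Prop :=
  vector_field W Xt /\
  (forall y : S, V y -> W (set_val y) -> forall a b,
     dom a y -> dom b (set_val y) ->
     Xt b (set_val y) = pushforward (@set_val T S) a b y (X a y)).

(* [nab] is the connection induced by [nabbar] and [pr]: local extensions of
   [X] and [Y] around [x] exist, and the projection of nabbar_Xt Yt at [x]
   equals nab_X Y at [x] for any choice of them. *)
Definition induced_connection (pr : T -> S)
    (nabbar : vfield A -> vfield A -> vfield A)
    (nab : vfield AS -> vfield AS -> vfield AS) : Prop :=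
  forall (V : set S) (X Y : vfield AS), open V ->
    vector_field V X -> vector_field V Y ->
  forall x : S, V x ->
    (exists W Xt Yt, [/\ open W, W (set_val x),
        vf_extends V W X Xt & vf_extends V W Y Yt]) /\
    (forall W Xt Yt, open W -> W (set_val x) ->
        vf_extends V W X Xt -> vf_extends V W Y Yt ->
      forall a b, dom a x -> dom b (set_val x) ->
        nab X Y a x =
        pushforward pr b a (set_val x) (nabbar Xt Yt b (set_val x))).
End induced.

Section cost.
Context {R : realType} {n : nat} {M M' : topologicalType}.
Variables (A : atlas R n M) (A' : atlas R n M') (c : M -> M' -> R).

Definition smooth_cost : Prop :=
  smooth_fun (prod_atlas A A') setT (fun x => c x.1 x.2).

Definition mixed_hessian (a : chart A) (b : chart A') (u w : 'rV[R]_n)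
  : 'M[R]_n :=
  \matrix_(i, j) partial i
    (fun u' => partial j (fun w' => c (param a u') (param b w')) w) u.

Definition nondegenerate_cost : Prop :=
  forall (a : chart A) (b : chart A') p q, dom a p -> dom b q ->
    mixed_hessian a b (coord a p) (coord b q) \in unitmx.

Definition cost_quad (ab : chart (prod_atlas A A')) (x : M * M')
    (v : 'rV[R]_(n + n)) : R :=
  - \sum_i \sum_j
      mixed_hessian ab.1 ab.2 (coord ab.1 x.1) (coord ab.2 x.2) i j
      * lsubmx v 0 i * rsubmx v 0 j.

(* h(v, v) = - c_{i:j} a^i b^j for v = (a, b), extended by polarization *)
Definition cost_metric : bilinear_field (prod_atlas A A') :=
  fun ab x v w =>
    2^-1 * (cost_quad ab x (v + w) - cost_quad ab x v - cost_quad ab x w).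

Definition c_concave (phi : M -> R) : Prop :=
  exists psi : M' -> \bar R, (forall q, psi q <> +oo%E) /\
    forall p, (phi p)%:E = ereal_inf [set ((c p q)%:E - psi q)%E | q in setT].

Definition c_transform (phi : M -> R) (q : M') : \bar R :=
  ereal_inf [set (c p q - phi p)%:E | p in setT].

(* f = D^c phi: f p is the unique q with phi(p) + psi(q) = c(p, q) *)
Definition c_gradient (phi : M -> R) (f : M -> M') : Prop :=
  forall p q, ((phi p)%:E + c_transform phi q = (c p q)%:E)%E <-> q = f p.

(* [f'] is total; only its values on the range of f, where it is the inverse
   of f, are constrained. *)
Definition diffeo_onto_range (f : M -> M') (f' : M' -> M) : Prop :=
  [/\ smooth_map A A' setT f, open (range f), cancel f f' &
      smooth_map A' A (range f) f'].

Variables (phi : M -> R) (f : M -> M').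

(* The c-transform is finite on the range of f, so that [fine] is harmless. *)
Definition c_divergence (x x' : graph_set f) : R :=
  c (set_val x).1 (set_val x').2 - phi (set_val x).1
  - fine (c_transform phi (set_val x').2).

Let AG := graph_atlas A f.

Definition div_coord (a : chart AG) (u u' : 'rV[R]_n) : R :=
  c_divergence (param a u) (param a u').

Definition div_metric (a : chart AG) (u : 'rV[R]_n) : 'M[R]_n :=
  \matrix_(i, j)
    - partial i (fun s => partial j (fun t => div_coord a s t) u) u.

Definition div_christoffel1 (a : chart AG) (u : 'rV[R]_n) (i j k : 'I_n) : R :=
  - partial i (fun s1 => partial j (fun s =>
      partial k (fun t => div_coord a s t) u) s1) u.

Definition dual_div_christoffel1 (a : chart AG) (u : 'rV[R]_n)
    (i j k : 'I_n) : R :=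
  - partial i (fun t1 => partial j (fun t =>
      partial k (fun s => div_coord a s t) u) t1) u.

Definition raise_index (G1 : chart AG -> 'rV[R]_n -> 'I_n -> 'I_n -> 'I_n -> R)
    (a : chart AG) (u : 'rV[R]_n) (i j k : 'I_n) : R :=
  \sum_m G1 a u i j m * invmx (div_metric a u) m k.

Definition primal_connection : vfield AG -> vfield AG -> vfield AG :=
  connection_of_christoffel (raise_index div_christoffel1).

Definition dual_connection : vfield AG -> vfield AG -> vfield AG :=
  connection_of_christoffel (raise_index dual_div_christoffel1).
End cost.
Arguments cost_metric {R n M M'} A A' c ab x v w.
Arguments primal_connection {R n M M'} A c phi f.
Arguments dual_connection {R n M M'} A c phi f.

Section projections.
Context {M M' : topologicalType} (f : M -> M') (f' : M' -> M).

Definition graph_proj0 (x : M * M') : graph_set f := graph_point f x.1.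

(* For x.2 in the range of f this is (f^-1 x.2, x.2). *)
Definition graph_proj1 (x : M * M') : graph_set f := graph_point f (f' x.2).
End projections.

(* Main.v *)
Require Import Defs.
From HB Require Import structures.
From mathcomp Require Import all_boot all_order all_algebra.
From mathcomp Require Import all_classical all_reals all_analysis.
From mathcomp Require Import ring lra.
Set Implicit Arguments.
Unset Strict Implicit.
Unset Printing Implicit Defensive.
Import Order.TTheory GRing.Theory Num.Theory.
Import numFieldNormedType.Exports.
Local Open Scope classical_set_scope.
Local Open Scope ring_scope.
Import Defs.

(** In a product chart let c_{ij:k'} etc. denote the derivatives of the cost.
    Testing Koszul's formula for h against constant fields (0, beta) and
    (alpha, 0), the third derivatives that mix the two factors cancel: only
    c_{ij:k'} enters the M-component of the Levi-Civita connection, and only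
    c_{k:i'j'} its M'-component.  If F is f in the charts, then
      g_ij = - c_{i:l'} d_j F^l',    Gamma_ijk = - c_{ij:l'} d_k F^l',
      Gamma*_ijk = - (c_{k:l'm'} d_i F^l' d_j F^m' + c_{k:l'} d_i d_j F^l').
    The first equality of connections is Koszul's identity tested on
    beta = d_k F.  The second one also needs that g is symmetric, which is the
    derivative of the first-order condition c_k(u, F u) = d_k phi(u) satisfied
    by the minimizer in the definition of the c-transform. *)

(** * Calculus of differentiable, C^k and smooth functions *)

Section differentiability.
Context {R : realType} {V W : normedModType R}.
Implicit Types (f g : V -> W) (U : set V).

(** The metric h pairs M-directions with M'-directions only; this is why a test field tangent to one
    factor isolates the component of the connection in the other. Since [nabbar] is given by its
    axioms alone, Koszul's formula is kept paired with a test vector and the symbols of h are never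
    computed. In charts the differential of [graph_proj0] is the first block, that of [graph_proj1]
    the differential of f' applied to the second block. The dual case is therefore checked after
    applying dF, where the second derivatives of F in Gamma* match those produced by differentiating
    a tangent field along the graph. The c-transform is an infimum, but at f(p) it equals c(p, f p)
    - phi(p), so the divergence is differentiable in charts. Indices can be raised because the
    matrix of g is minus the mixed Hessian times the Jacobian of F, both invertible. The technical
    obstacle is locality: components are constrained only on the open set of the field and the
    domain of the chart, so identities of functions are mostly used near a point, and extensions off
    the graph have to be built. *)

Lemma near_eq_differentiable f g x :
  (\forall y \near x, f y = g y) -> differentiable f x -> differentiable g x.
Proof.
move=> fg df.
(* The difference g - f vanishes near x, hence is little-o of the identity there, and [diff_unique]
   identifies its differential as zero. *)
suff dk : differentiable (g - f) x.
  by have := differentiableD df dk; rewrite addrC subrK.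
have k0 : (g - f) \o shift x = cst ((g - f) x) + \0 +o_ (0 : V) id.
  apply/eqaddoP => _/posnumP[e] /=.
  have : \forall z \near (0 : V), f (z + x) = g (z + x).
    by move: fg; rewrite (near_shift 0) subr0.
  apply: filterS => z fgz.
  have -> : ((g - f) \o shift x - (cst ((g - f) x) + \0)) z = 0.
    rewrite !fctE /= fgz (nbhs_singleton fg) !subrr addr0 oppr0 addr0.
    by [].
  by rewrite normr0 mulr_ge0.
have c0 : continuous (\0 : V -> W) by exact: cst_continuous.
have d0 := diff_unique c0 k0.
by apply/diff_locallyP; rewrite d0; split.
Qed.

Lemma near_eq_diff f g x : (\forall y \near x, f y = g y) ->
  differentiable f x -> 'd f x = 'd g x :> (V -> W).
Proof.
move=> fg df; apply/funext => v.
rewrite -!deriveE ?(near_eq_derive _ fg)//.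
exact: near_eq_differentiable df.
Qed.

Lemma open_in_near U x (P : V -> Prop) :
  open U -> U x -> (forall y, U y -> P y) -> \forall y \near x, P y.
Proof. by move=> oU Ux UP; apply: filterS UP _; exact: open_nbhs_nbhs. Qed.

Lemma Ck_subset k U U' g : U `<=` U' -> Ck k U' g -> Ck k U g.
Proof.
elim: k g => [|k IH] g UU' /=; first by move=> + x /UU'; exact.
by move=> [dg Dg]; split=> [x /UU'/dg//|v]; exact: IH.
Qed.

Lemma smooth_subset U U' g : U `<=` U' -> smooth U' g -> smooth U g.
Proof. by move=> UU' + k => /(_ k); exact: Ck_subset. Qed.

(** Derivatives off [U] are unconstrained, so a formula for ['D_v] is available on [U] only; this
    lemma lets the inductions below replace a derivative by such a formula. *)
Lemma Ck_eq k U f g : open U -> (forall x, U x -> f x = g x) ->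
  Ck k U f -> Ck k U g.
Proof.
elim: k f g => [|k IH] f g oU fg /=.
  move=> cf x Ux; move: (cf x Ux : f @ x --> f x); rewrite fg//.
  rewrite /prop_for /continuous_at.
  apply: cvg_trans; apply: near_eq_cvg => /=.
  by apply: (open_in_near oU Ux) => y /fg.
move=> [df Df]; split=> [x Ux|v].
  by apply: near_eq_differentiable (df x Ux); apply: (open_in_near oU Ux).
apply: IH (Df v) => // x Ux.
by apply: near_eq_derive; apply: (open_in_near oU Ux).
Qed.

Lemma smooth_eq U f g : open U -> (forall x, U x -> f x = g x) ->
  smooth U f -> smooth U g.
Proof. by move=> oU fg sf k; apply: (Ck_eq oU fg). Qed.

Lemma smooth_differentiable U g x : smooth U g -> U x -> differentiable g x.
Proof. by move=> /(_ 1%N)[dg _]; exact: dg. Qed.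

Lemma smooth_derive U g v : smooth U g -> smooth U ('D_v g).
Proof. by move=> sg k; have [_] := sg k.+1; apply. Qed.

Lemma smooth_continuous U g x : smooth U g -> U x -> {for x, continuous g}.
Proof. by move=> /(_ 0%N) /= cg; exact: cg. Qed.

Lemma Ck_cst k U (a : W) : Ck k U (cst a).
Proof.
elim: k a => [|k IH] a /=; first by move=> x _; exact: cst_continuous.
split=> [x _|v]; first exact: differentiable_cst.
suff -> : 'D_v (cst a) = cst (0 : W) by exact: IH.
by apply/funext => x; rewrite derive_cst.
Qed.

Lemma Ck_continuous k U g x : Ck k U g -> U x -> {for x, continuous g}.
Proof.
case: k => [|k] /=; first by move=> cg; exact: cg.
by move=> [dg _] /dg; exact: differentiable_continuous.
Qed.

(** Lowers the order of the factor that stays undifferentiated in the product and chain rules. *)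
Lemma CkS k U g : Ck k.+1 U g -> Ck k U g.
Proof.
elim: k g => [|k IH] g; first by move=> Ckg x Ux; exact: Ck_continuous Ckg Ux.
by move=> [dg Dg]; split=> // v; apply: IH (Dg v).
Qed.

Lemma CkD k U f g : open U -> Ck k U f -> Ck k U g -> Ck k U (f + g).
Proof.
move=> oU; elim: k f g => [|k IH] f g.
  by move=> cf cg x Ux; apply: continuousD; [exact: cf|exact: cg].
move=> [df Df] [dg Dg]; split=> [x Ux|v].
  by apply: differentiableD; [exact: df|exact: dg].
apply: (Ck_eq (f := 'D_v f + 'D_v g)) => //; last exact: IH (Df v) (Dg v).
move=> x Ux; have dfx := df x Ux; have dgx := dg x Ux.
by rewrite deriveD//; exact: diff_derivable.
Qed.

Lemma Ck_sum k U (I : Type) (r : seq I) (F : I -> V -> W) : open U ->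
  (forall i, Ck k U (F i)) -> Ck k U (fun x => \sum_(i <- r) F i x).
Proof.
move=> oU CF; elim: r => [|i r IH].
  under eq_fun do rewrite big_nil; exact: Ck_cst.
under eq_fun do rewrite big_cons; exact: (CkD oU (CF i) IH).
Qed.

End differentiability.

Section linear.
Context {R : realType} {V W W' : normedModType R}.

Lemma derive_linear (L : {linear W -> W'}) (f : V -> W) x v :
  continuous L -> differentiable f x -> 'D_v (L \o f) x = L ('D_v f x).
Proof.
move=> cL df; have dL y : differentiable L y by exact: linear_differentiable.
rewrite [LHS]deriveE; last exact: differentiable_comp.
by rewrite diff_comp// [LHS]/= diff_lin// deriveE.
Qed.

Lemma Ck_linear k U (L : {linear W -> W'}) (f : V -> W) : open U ->
  continuous L -> Ck k U f -> Ck k U (L \o f).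
Proof.
move=> oU cL; elim: k f => [|k IH] f.
  by move=> cf x Ux; apply: continuous_comp; [exact: cf|exact: cL].
move=> [df Df]; split=> [x Ux|v].
  apply: differentiable_comp; first exact: df.
  exact: linear_differentiable.
apply: (Ck_eq (f := L \o 'D_v f)) => //; last exact: IH (Df v).
by move=> x Ux; rewrite derive_linear//; exact: df.
Qed.

Lemma Ck_linear_map k U (L : {linear V -> W}) : continuous L -> Ck k U L.
Proof.
move=> cL; case: k => [|k] /=; first by move=> x _; exact: cL.
split=> [x _|v]; first exact: linear_differentiable.
suff -> : 'D_v L = cst (L v) by exact: Ck_cst.
by apply/funext => x; rewrite deriveE ?diff_lin//; exact: linear_differentiable.
Qed.
End linear.

Section scale.
Context {R : realType} {V W : normedModType R}.

(** Registers scaling as a bilinear map, so that the product rule in [differentiable_scale] is the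
    differential of a continuous bilinear map. *)
Lemma scaler_is_bilinear :
  bilinear_for
    (GRing.Scale.Law.clone _ _ *:%R _) (GRing.Scale.Law.clone _ _ *:%R _)
    (@GRing.scale R W).
Proof.
split=> [u'|u] a x y /=; first by rewrite scalerDl scalerA.
by rewrite scalerDr !scalerA mulrC.
Qed.
HB.instance Definition _ := bilinear_isBilinear.Build R R W W _ _
  (@GRing.scale R W) scaler_is_bilinear.

Lemma differentiable_scale (k : V -> R) (f : V -> W) x :
  differentiable k x -> differentiable f x ->
  differentiable (fun y => k y *: f y) x /\
  forall v, 'D_v (fun y => k y *: f y) x = k x *: 'D_v f x + 'D_v k x *: f x.
Proof.
move=> dk df; pose B p := @GRing.scale R W p.1 p.2.
have cB : continuous B by exact: scale_continuous.
have dB : differentiable B (k x, f x) by exact: differentiable_bilin.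
have dkf := differentiable_pair dk df.
have dc : differentiable (B \o (fun y => (k y, f y))) x.
  exact: differentiable_comp.
split=> // v; rewrite [LHS]deriveE//.
rewrite -[X in 'd X x]/(B \o (fun y => (k y, f y))) diff_comp//.
by rewrite [LHS]/= diff_pair// /B diff_bilin//= -!deriveE.
Qed.

Lemma CkZ n U (k : V -> R) (f : V -> W) : open U ->
  Ck n U k -> Ck n U f -> Ck n U (fun y => k y *: f y).
Proof.
move=> oU; elim: n k f => [|n IH] k f.
  move=> ck cf x Ux; apply: continuousZ; [exact: ck|exact: cf].
move=> Ck1 Cf1; have [[dk Dk] [df Df]] := (Ck1, Cf1).
split=> [x Ux|v].
  by have [] := differentiable_scale (dk x Ux) (df x Ux).
apply: (Ck_eq (f :=
  (fun y => k y *: 'D_v f y) + (fun y => 'D_v k y *: f y))) => //.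
  by move=> x Ux; have [_ ->] := differentiable_scale (dk x Ux) (df x Ux).
by apply: (CkD oU); [exact: IH (CkS Ck1) (Df v)|exact: IH (Dk v) (CkS Cf1)].
Qed.
End scale.

Section row_vectors.
Context {R : realType}.

Definition coordf m (i : 'I_m) (u : 'rV[R]_m) : R := u 0 i.

Lemma coordf_is_linear m (i : 'I_m) : linear (@coordf m i).
Proof. by move=> a u v; rewrite /coordf !mxE. Qed.

HB.instance Definition _ m (i : 'I_m) :=
  GRing.isLinear.Build R 'rV[R]_m R _ (coordf i) (coordf_is_linear i).

(** A linear map on row vectors is a finite sum of coordinates scaling fixed vectors; its continuity
    is the case k = 0 of [Ck_sum]. *)
Lemma linear_rV_continuous m (W : normedModType R)
    (L : {linear 'rV[R]_m -> W}) : continuous L.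
Proof.
have -> : (L : _ -> _) = (fun u => \sum_(i < m) u 0 i *: L (delta_mx 0 i)).
  by apply/funext => u; rewrite [in LHS](row_sum_delta u) linear_sum;
    apply: eq_bigr => i _; rewrite linearZ.
have C0 : Ck 0 setT (fun u : 'rV[R]_m => \sum_(i < m) u 0 i *: L (delta_mx 0 i)).
  apply: Ck_sum => [|i u _]; first exact: openT.
  by apply: continuousZ; [exact: coord_continuous|exact: cst_continuous].
by move=> u; exact: C0.
Qed.

Lemma diff_rV m (W : normedModType R) (g : 'rV[R]_m -> W) x v : 
  'd g x v = \sum_(i < m) v 0 i *: 'd g x (delta_mx 0 i).
Proof.
rewrite [in LHS](row_sum_delta v) linear_sum.
by apply: eq_bigr => i _; rewrite linearZ.
Qed.

End row_vectors.

Section row_vector_fields.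
Context {R : realType} {V : normedModType R}.

Lemma Ck_mulmxr k m p (U : set V) (f : V -> 'rV[R]_m) (B : 'M[R]_(m, p)) :
  open U -> Ck k U f -> Ck k U (fun x => f x *m B).
Proof.
by move=> oU; apply: (Ck_linear (L := mulmxr B)) => //; exact: linear_rV_continuous.
Qed.

Lemma derive_mulmxr m p (f : V -> 'rV[R]_m) (B : 'M[R]_(m, p)) x v :
  differentiable f x -> 'D_v (fun y => f y *m B) x = 'D_v f x *m B.
Proof.
by move=> df; rewrite (derive_linear (L := mulmxr B))//; exact: linear_rV_continuous.
Qed.

Lemma differentiable_mulmxr m p (f : V -> 'rV[R]_m) (B : 'M[R]_(m, p)) x :
  differentiable f x -> differentiable (fun y => f y *m B) x.
Proof.
move=> df; apply: (@differentiable_comp _ _ _ _ f (mulmxr B)) => //.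
apply: linear_differentiable; exact: linear_rV_continuous.
Qed.

(** Block operations become right multiplications by constant matrices, so the lemmas on continuous
    linear maps cover them. *)
Lemma row_mxE m p (u : 'rV[R]_m) (w : 'rV[R]_p) :
  row_mx u w = u *m row_mx 1%:M 0 + w *m row_mx 0 1%:M.
Proof.
by rewrite !mul_mx_row !mulmx1 !mulmx0 add_row_mx addr0 add0r.
Qed.

Lemma lsubmxE m p (u : 'rV[R]_(m + p)) : lsubmx u = u *m col_mx 1%:M 0.
Proof.
by rewrite -[in RHS](hsubmxK u) mul_row_col mulmx1 mulmx0 addr0.
Qed.

Lemma rsubmxE m p (u : 'rV[R]_(m + p)) : rsubmx u = u *m col_mx 0 1%:M.
Proof.
by rewrite -[in RHS](hsubmxK u) mul_row_col mulmx1 mulmx0 add0r.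
Qed.

Lemma Ck_row_mx k m p (U : set V) (f : V -> 'rV[R]_m) (g : V -> 'rV[R]_p) :
  open U -> Ck k U f -> Ck k U g -> Ck k U (fun x => row_mx (f x) (g x)).
Proof.
move=> oU cf cg; under eq_fun do rewrite row_mxE.
by apply: CkD => //; exact: Ck_mulmxr.
Qed.

Lemma Ck_lsubmx k m p (U : set V) (f : V -> 'rV[R]_(m + p)) :
  open U -> Ck k U f -> Ck k U (fun x => lsubmx (f x)).
Proof.
by move=> oU cf; under eq_fun do rewrite lsubmxE; exact: Ck_mulmxr.
Qed.

Lemma Ck_rsubmx k m p (U : set V) (f : V -> 'rV[R]_(m + p)) :
  open U -> Ck k U f -> Ck k U (fun x => rsubmx (f x)).
Proof.
by move=> oU cf; under eq_fun do rewrite rsubmxE; exact: Ck_mulmxr.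
Qed.

Lemma differentiable_row_mx m p (f : V -> 'rV[R]_m) (g : V -> 'rV[R]_p) x :
  differentiable f x -> differentiable g x ->
  differentiable (fun y => row_mx (f y) (g y)) x.
Proof.
move=> df dg; under eq_fun do rewrite row_mxE.
by apply: differentiableD; exact: differentiable_mulmxr.
Qed.

Lemma derive_row_mx m p (f : V -> 'rV[R]_m) (g : V -> 'rV[R]_p) x v :
  differentiable f x -> differentiable g x ->
  'D_v (fun y => row_mx (f y) (g y)) x = row_mx ('D_v f x) ('D_v g x).
Proof.
move=> df dg; under eq_fun do rewrite row_mxE.
rewrite [LHS]deriveD; try exact/diff_derivable/differentiable_mulmxr.
by rewrite !derive_mulmxr// -row_mxE.
Qed.

Lemma differentiable_coordf m (f : V -> 'rV[R]_m) i x :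
  differentiable f x -> differentiable (fun y => f y 0 i) x.
Proof.
by move=> df; apply: (@differentiable_comp _ _ _ _ f (fun u : 'rV[R]_m => u 0 i)) => //;
  exact: differentiable_coord.
Qed.

Lemma derive_coordf m (f : V -> 'rV[R]_m) i x v :
  differentiable f x -> 'D_v (fun y => f y 0 i) x = 'D_v f x 0 i.
Proof.
move=> df; apply: (derive_linear (L := coordf i)) => //.
exact: linear_rV_continuous.
Qed.

Lemma Ck_coordf k m (U : set V) (f : V -> 'rV[R]_m) i :
  open U -> Ck k U f -> Ck k U (fun x => f x 0 i).
Proof.
move=> oU; apply: (Ck_linear (L := coordf i)) => //.
exact: linear_rV_continuous.
Qed.

End row_vector_fields.

(** The chain rule differentiates g in the moving direction ['D_v f x], whereas [Ck] speaks of fixed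
    directions. Expanding that direction in the standard basis leaves products of its coordinates
    with partial derivatives of g composed with f, to which the induction hypothesis applies. *)
Lemma Ck_comp {R : realType} {V W : normedModType R} m k (U : set V)
    (O : set 'rV[R]_m) (f : V -> 'rV[R]_m) (g : 'rV[R]_m -> W) :
  open U -> (forall x, U x -> O (f x)) -> Ck k U f -> Ck k O g ->
  Ck k U (g \o f).
Proof.
move=> oU fO; elim: k g => [|k IH] g.
  move=> cf cg x Ux; apply: continuous_comp; [exact: cf|exact/cg/fO].
move=> Cf [dg Dg]; have [df Df] := Cf; split=> [x Ux|v].
  by apply: differentiable_comp; [exact: df|exact/dg/fO].
apply: (Ck_eq (f := fun x => \sum_(i < m)
  'D_v f x 0 i *: ('D_(delta_mx 0 i) g \o f) x)) => //.
  move=> x Ux; have dfx := df x Ux; have dgx := dg _ (fO x Ux).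
  rewrite [RHS]deriveE; last exact: differentiable_comp.
  rewrite diff_comp// [RHS]/= diff_rV; apply: eq_bigr => i _.
  by rewrite [in LHS]deriveE//; congr (_ *: _); rewrite /= deriveE.
apply: Ck_sum => // i; apply: CkZ => //.
  by apply: Ck_coordf => //; exact: Df.
exact: IH (CkS Cf) (Dg _).
Qed.

Section smooth_closure.
Context {R : realType} {V : normedModType R}.
Implicit Types U : set V.

Lemma smooth_cst (W : normedModType R) U (a : W) : smooth U (cst a).
Proof. by move=> k; exact: Ck_cst. Qed.

Lemma smooth_sum (W : normedModType R) U (I : Type) (r : seq I)
    (F : I -> V -> W) : open U ->
  (forall i, smooth U (F i)) -> smooth U (fun x => \sum_(i <- r) F i x).
Proof. by move=> oU sF k; apply: Ck_sum => // i; exact: sF. Qed.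

Lemma smoothZ (W : normedModType R) U (k : V -> R) (f : V -> W) :
  open U -> smooth U k -> smooth U f -> smooth U (fun x => k x *: f x).
Proof. by move=> oU sk sf n; exact: CkZ. Qed.

Lemma smooth_row_mx m p U (f : V -> 'rV[R]_m) (g : V -> 'rV[R]_p) :
  open U -> smooth U f -> smooth U g -> smooth U (fun x => row_mx (f x) (g x)).
Proof. by move=> oU sf sg k; exact: Ck_row_mx. Qed.

Lemma smooth_lsubmx m p U (f : V -> 'rV[R]_(m + p)) :
  open U -> smooth U f -> smooth U (fun x => lsubmx (f x)).
Proof. by move=> oU sf k; exact: Ck_lsubmx. Qed.

Lemma smooth_rsubmx m p U (f : V -> 'rV[R]_(m + p)) :
  open U -> smooth U f -> smooth U (fun x => rsubmx (f x)).
Proof. by move=> oU sf k; exact: Ck_rsubmx. Qed.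

Lemma smooth_coordf m U (f : V -> 'rV[R]_m) i :
  open U -> smooth U f -> smooth U (fun x => f x 0 i).
Proof. by move=> oU sf k; exact: Ck_coordf. Qed.

Lemma smooth_comp m (W : normedModType R) U (O : set 'rV[R]_m)
    (f : V -> 'rV[R]_m) (g : 'rV[R]_m -> W) :
  open U -> (forall x, U x -> O (f x)) -> smooth U f -> smooth O g ->
  smooth U (g \o f).
Proof. by move=> oU fO sf sg k; exact: (Ck_comp oU fO). Qed.

End smooth_closure.

Lemma smooth_id {R : realType} m (U : set 'rV[R]_m) : smooth U id.
Proof.
by move=> k; apply: (@Ck_linear_map _ _ _ k U idfun) => x; exact: cvg_id.
Qed.

Lemma derive_comp {R : realType} {U V W : normedModType R}
    (f : U -> V) (g : V -> W) x v :
  differentiable f x -> differentiable g (f x) ->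
  'D_v (g \o f) x = 'D_('D_v f x) g (f x).
Proof.
move=> df dg; rewrite [LHS]deriveE; last exact: differentiable_comp.
by rewrite diff_comp// [LHS]/= !deriveE.
Qed.

(** * Fermat's rule and the symmetry of second derivatives *)

Lemma dist_le_eps (R : realFieldType) (e a b y y' : R) :
  y' = y -> `|a - y| < e / 2 -> `|b - y'| < e / 2 -> `|a - b| <= e.
Proof.
move=> -> ay yb; rewrite -(subrKA y) (le_trans (ler_normD _ _))//.
by rewrite (splitr e) lerD// ltW// distrC.
Qed.

Section second_derivative.
Context {R : realType} {V : normedModType R}.

(** Restriction to a line, through which the one-variable theorems on extrema and mean values are
    applied. *)
Lemma is_derive_line (g : V -> R) x v t : differentiable g (x + t *: v) ->
  is_derive t 1 (fun s : R => g (x + s *: v)) ('D_v g (x + t *: v)).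
Proof.
move=> dg; pose l : R -> V := cst x + (fun s => s *: v).
have dv : is_diff t ( *:%R ^~ v) ( *:%R ^~ v) by exact: is_diff_scalel.
have dc := differentiable_cst x t.
have dlt : differentiable l t by exact: differentiableD dc ex_diff.
have dl1 : 'd l t 1 = v.
  have -> := diffD dc (@ex_diff _ _ _ _ _ _ _ dv).
  rewrite fctE diff_cst (diff_val (is_diff_def := dv)).
  by rewrite -[RHS]add0r -[in RHS](scale1r v).
have dgl : differentiable (g \o l) t by exact: differentiable_comp.
apply: DeriveDef; first exact: diff_derivable.
rewrite [LHS]deriveE// diff_comp// [LHS]/= dl1.
by rewrite -deriveE.
Qed.

Lemma derive_min (U : set V) (g : V -> R) x v : open U -> U x ->
  (forall y, U y -> g x <= g y) -> (forall y, U y -> differentiable g y) ->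
  'D_v g x = 0.
Proof.
move=> oU Ux gmin dg.
have : \forall t \near (0 : R), U (x + t *: v).
  have cl : (fun t : R => x + t *: v) @ 0 --> x + 0 *: v.
    by apply: cvgD; [exact: cvg_cst|apply: cvgZr_tmp; exact: cvg_id].
  by apply: cl; rewrite scale0r addr0; exact: open_nbhs_nbhs.
move=> /nbhs_ballP[e /= e0 He].
have Ue t : t \in `](- e), e[ -> U (x + t *: v).
  rewrite in_itv/= => te; apply: He; rewrite /ball/= sub0r normrN ltr_norml.
  by [].
have := @derive1_at_min R (fun t => g (x + t *: v)) (- e) e 0.
case.
- by rewrite ge0_cp// ltW.
- by move=> t /Ue/dg/is_derive_line[].
- by rewrite in_itv/= oppr_lt0 e0.
- by move=> t /Ue; rewrite scale0r addr0; exact: gmin.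
have dg0 : differentiable g (x + (0 : R) *: v) by rewrite scale0r addr0; exact: dg.
by move=> _; have [_ ->] := is_derive_line dg0; rewrite scale0r addr0.
Qed.

(** Two mean value theorems: one in direction v for the increment of g along h w, then one in
    direction w for ['D_v g]. *)
Lemma second_difference (g : V -> R) x v w h : 0 < h ->
  (forall s t, 0 <= s <= h -> 0 <= t <= h ->
    differentiable g (x + s *: v + t *: w) /\
    differentiable ('D_v g) (x + s *: v + t *: w)) ->
  exists s t, [/\ 0 <= s <= h, 0 <= t <= h &
    (g (x + h *: v + h *: w) - g (x + h *: w)) - (g (x + h *: v) - g x) =
    h * (h * 'D_w ('D_v g) (x + s *: v + t *: w))].
Proof.
move=> h0 dg; have h00 : 0 <= h <= h by rewrite lexx ltW.
have h01 : 0 <= (0:R) <= h by rewrite lexx ltW.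
have dF t : 0 <= t <= h -> is_derive t 1
    (fun s : R => g (x + h *: w + s *: v) - g (x + s *: v))
    ('D_v g (x + t *: v + h *: w) - 'D_v g (x + t *: v)).
  move=> th; apply: is_deriveB.
    rewrite addrAC; apply: is_derive_line; rewrite addrAC.
    by have [] := dg _ _ th h00.
  apply: is_derive_line.
  by have [] := dg _ _ th h01; rewrite scale0r addr0.
have [||s sh] := @MVT_segment R
    (fun s : R => g (x + h *: w + s *: v) - g (x + s *: v))
    (fun t => 'D_v g (x + t *: v + h *: w) - 'D_v g (x + t *: v)) 0 h (ltW h0) _ _.
- by move=> t; rewrite in_itv/= => /andP[? ?]; apply: dF; rewrite !ltW.
- apply: derivable_within_continuous => t; rewrite in_itv/= => th.
  by have [] := dF _ th.
have {}sh : 0 <= s <= h by move: sh; rewrite in_itv.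
rewrite subr0 scale0r !addr0 (addrAC x (h *: v) (h *: w)) => E1.
(* Regroups the second difference as the increment of the function to which the mean value theorem
   was applied. *)
have -> (a b c e : R) : (a - b) - (c - e) = (a - c) - (b - e) by ring.
rewrite {}E1.
have dG t : 0 <= t <= h -> is_derive t 1
    (fun t : R => 'D_v g (x + s *: v + t *: w))
    ('D_w ('D_v g) (x + s *: v + t *: w)).
  by move=> th; apply: is_derive_line; have [] := dg _ _ sh th.
have [||t th] := @MVT_segment R
    (fun t : R => 'D_v g (x + s *: v + t *: w))
    (fun t : R => 'D_w ('D_v g) (x + s *: v + t *: w)) 0 h (ltW h0) _ _.
- by move=> t; rewrite in_itv/= => /andP[? ?]; apply: dG; rewrite !ltW.
- apply: derivable_within_continuous => t; rewrite in_itv/= => th.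
  by have [] := dG _ th.
have {}th : 0 <= t <= h by move: th; rewrite in_itv.
rewrite subr0 scale0r addr0 => ->.
by exists s, t; split=> //; rewrite mulrC [in RHS](mulrC h ('D_w _ _)).
Qed.

Lemma small_parallelogram x v w (N : set V) : nbhs x N ->
  exists2 h : R, 0 < h & forall s t, 0 <= s <= h -> 0 <= t <= h ->
    N (x + s *: v + t *: w).
Proof.
move=> /nbhs_ballP[e /= e0 He].
(* The summand 1 keeps the divisor positive when v = w = 0 and makes the final estimate strict. *)
have k0 : 0 < `|v| + `|w| + 1 by rewrite ltr_wpDl// addr_ge0.
exists (e / (`|v| + `|w| + 1)) => [|s t /andP[s0 sh] /andP[t0 th]].
  exact: divr_gt0.
apply: He; rewrite -ball_normE /ball_/= -addrA opprD addNKr normrN.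
apply: (le_lt_trans (ler_normD _ _)); rewrite !normrZ !ger0_norm//.
rewrite (@le_lt_trans _ _ (e / (`|v| + `|w| + 1) * (`|v| + `|w|)))//.
  by rewrite mulrDr lerD// ler_wpM2r.
by rewrite mulrAC ltr_pdivrMr// ltr_pM2l// ltrDl.
Qed.

(** The second difference is symmetric in v and w, so both mixed derivatives take a common value at
    two points of a small parallelogram; by continuity each is within e / 2 of its value at x. *)
Lemma schwarz (U : set V) (g : V -> R) x v w : open U -> smooth U g -> U x ->
  'D_v ('D_w g) x = 'D_w ('D_v g) x.
Proof.
move=> oU sg Ux; apply/eqP; rewrite -subr_eq0 -normr_le0.
apply/ler_addgt0Pr => e e0; rewrite add0r.
have e20 : 0 < e / 2 by rewrite divr_gt0.
have near1 a b : nbhs x [set y | U y /\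
    `|'D_a ('D_b g) x - 'D_a ('D_b g) y| < e / 2].
  apply: filterI; first exact: open_nbhs_nbhs.
  have : {for x, continuous ('D_a ('D_b g))}.
    apply: (smooth_continuous (U := U)) => //.
    exact/smooth_derive/smooth_derive.
  by move=> /cvgrPdist_lt; exact.
have [h h0 Hh] := small_parallelogram v w (filterI (near1 v w) (near1 w v)).
have hd s t : 0 <= s <= h -> 0 <= t <= h -> U (x + s *: v + t *: w).
  by move=> sh th; have [[]] := Hh s t sh th.
have [s [t [sh th E1]]] : exists s t, [/\ 0 <= s <= h, 0 <= t <= h &
    (g (x + h *: v + h *: w) - g (x + h *: w)) - (g (x + h *: v) - g x) =
    h * (h * 'D_w ('D_v g) (x + s *: v + t *: w))].
  apply: second_difference => // s t sh th; have Uy := hd s t sh th.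
  by split; apply: (smooth_differentiable (U := U)) => //; exact: smooth_derive.
have [t' [s' [th' sh' E2]]] : exists s t, [/\ 0 <= s <= h, 0 <= t <= h &
    (g (x + h *: w + h *: v) - g (x + h *: v)) - (g (x + h *: w) - g x) =
    h * (h * 'D_v ('D_w g) (x + t *: v + s *: w))].
  case: (@second_difference g x w v h h0) => [t' s' th' sh'|s' [t' [sh' th' E2]]];
    last by exists s', t'; split; [| |exact: (etrans E2
      (congr1 (fun y => h * (h * 'D_v ('D_w g) y)) (addrAC _ _ _)))].
  have := hd s' t' sh' th'; rewrite addrAC => Uy.
  by split; apply: (smooth_differentiable (U := U)) => //; exact: smooth_derive.
(* Multiplied by h twice, both sides are the same second difference. *)
have E : 'D_w ('D_v g) (x + s *: v + t *: w) =
    'D_v ('D_w g) (x + s' *: v + t' *: w).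
  apply: (mulfI (lt0r_neq0 h0)); apply: (mulfI (lt0r_neq0 h0)).
  apply: (etrans (esym E1)); apply: (etrans _ E2).
  by rewrite (addrAC x (h *: w)); ring.
have [[_ H1] _] := Hh _ _ sh' th'.
have [_ [_ H2]] := Hh _ _ sh th.
exact: (dist_le_eps E H1 H2).
Qed.
End second_derivative.

(** * Charts, vector fields and pushforwards *)

Lemma open_setI_preimage (T1 T2 : topologicalType) (O : set T1) (f : T1 -> T2)
    (U : set T2) : open O -> (forall x, O x -> {for x, continuous f}) ->
  open U -> open (O `&` f @^-1` U).
Proof.
move=> oO cf oU; rewrite openE => x [Ox Ux]; apply: filterI.
  exact: open_nbhs_nbhs.
by apply: (cf x Ox); exact: open_nbhs_nbhs.
Qed.

Section charts.
Context {R : realType} {d : nat} {T : topologicalType}.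
Variables (A : atlas R d T) (hA : smooth_atlas A).
Implicit Types (a b : chart A) (U : set T).

Lemma dom_open a : open (dom a).
Proof. by have [_ [/(_ a)[]]] := hA. Qed.

Lemma codom_open a : open (coord a @` dom a).
Proof. by have [_ [/(_ a)[]]] := hA. Qed.

Lemma chart_coordK a p : dom a p -> param a (coord a p) = p.
Proof. by have [_ [/(_ a)[_ _ K _ _] _]] := hA; exact: K. Qed.

Lemma coord_continuous_dom a p : dom a p -> {for p, continuous (coord a)}.
Proof. by have [_ [/(_ a)[_ _ _ c _] _]] := hA; exact: c. Qed.

Lemma param_continuous a u : (coord a @` dom a) u ->
  {for u, continuous (param a)}.
Proof. by have [_ [/(_ a)[_ _ _ _ c] _]] := hA; exact: c. Qed.

Lemma image_coordP a U u :
  (coord a @` (U `&` dom a)) u <->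
  [/\ (coord a @` dom a) u, coord a (param a u) = u, dom a (param a u) &
      U (param a u)].
Proof.
split=> [[p [Up ap] <-]|[_ uE ap Up]]; last by exists (param a u).
by rewrite chart_coordK//; split=> //; exists p.
Qed.

Lemma image_coord_mem a U p : U p -> dom a p ->
  (coord a @` (U `&` dom a)) (coord a p).
Proof. by exists p. Qed.

Lemma image_coord_open a U : open U -> open (coord a @` (U `&` dom a)).
Proof.
move=> oU.
have -> : coord a @` (U `&` dom a) = coord a @` dom a `&` param a @^-1` U.
  apply/seteqP; split=> u; first by move/image_coordP => [].
  by move=> [[p ap <-]]; rewrite /preimage/= chart_coordK// => Up; exists p.
apply: open_setI_preimage => //; first exact: codom_open.
by move=> u; exact: param_continuous.
Qed.

Lemma near_image_coord a U p : open U -> U p -> dom a p ->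
  \forall u \near coord a p, [/\ coord a (param a u) = u, dom a (param a u) &
    U (param a u)].
Proof.
move=> oU Up ap.
have Uap := image_coord_mem Up ap.
apply: filterS (open_nbhs_nbhs (conj (image_coord_open oU) Uap)).
by move=> u /image_coordP[].
Qed.

Lemma transition_smooth a b :
  smooth (coord a @` (dom a `&` dom b)) (coord b \o param a).
Proof. by have [_ [_ /(_ a b)]] := hA. Qed.

Lemma transition_differentiable a b p : dom a p -> dom b p ->
  differentiable (coord b \o param a) (coord a p).
Proof.
move=> ap bp; apply: (smooth_differentiable (@transition_smooth a b)).
by exists p.
Qed.

Lemma pushforward_id a p v : dom a p -> pushforward idfun a a p v = v.
Proof.
move=> ap; rewrite /pushforward.
have E : \forall u \near coord a p, id u = (coord a \o idfun \o param a) u.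
  have := near_image_coord (U := setT) openT (I : setT p) ap.
  by apply: filterS => u [].
rewrite -(near_eq_diff E); last by apply: ex_diff.
by rewrite diff_val.
Qed.

Lemma vector_field_subset U U' (X : vfield A) : U `<=` U' ->
  vector_field U' X -> vector_field U X.
Proof.
move=> UU' [X1 X2]; split=> [a b p /UU'|a]; first exact: X1.
by apply: smooth_subset (X2 a) => _ [p [/UU' Up ap] <-]; exists p.
Qed.

Lemma dirE U (X Y : vfield A) a p : vector_field U Y -> U p -> dom a p ->
  dir X Y a p = 'D_(X a p) (Y a \o param a) (coord a p).
Proof.
move=> [_ sY] Up ap; rewrite deriveE//.
by apply: (smooth_differentiable (sY a)); exact: image_coord_mem.
Qed.

End charts.

Section pushforward_chain.
Context {R : realType} {d1 d2 d3 : nat} {T1 T2 T3 : topologicalType}.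
Variables (A1 : atlas R d1 T1) (A2 : atlas R d2 T2) (A3 : atlas R d3 T3).
Hypotheses (h1 : smooth_atlas A1) (h2 : smooth_atlas A2).

(** Continuity keeps F in the domain of the middle chart [b] near p; there [param b] cancels
    [coord b], and the chain rule applies to the coordinate expressions. *)
Lemma pushforward_comp (F : T1 -> T2) (G : T2 -> T3) (a : chart A1)
    (b : chart A2) (c : chart A3) p v :
  dom a p -> dom b (F p) -> {for p, continuous F} ->
  differentiable (coord b \o F \o param a) (coord a p) ->
  differentiable (coord c \o G \o param b) (coord b (F p)) ->
  pushforward G b c (F p) (pushforward F a b p v) =
  pushforward (G \o F) a c p v.
Proof.
move=> ap bFp cF dF dG; rewrite /pushforward.
have ap' := chart_coordK h1 ap.
have dG' : differentiable (coord c \o G \o param b)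
    ((coord b \o F \o param a) (coord a p)) by rewrite /= ap'.
have E : \forall u \near coord a p,
    ((coord c \o G \o param b) \o (coord b \o F \o param a)) u =
    (coord c \o (G \o F) \o param a) u.
  have nb : nbhs (coord a p) ((F \o param a) @^-1` dom b).
    have cp : {for coord a p, continuous (param a)}.
      by apply: (param_continuous h1); exists p.
    have cFp : {for coord a p, continuous (F \o param a)}.
      by apply: continuous_comp => //; rewrite ap'.
    apply: cFp; rewrite /= ap'.
    by apply: open_nbhs_nbhs; split=> //; exact: (dom_open h2).
  by apply: filterS nb => u /= bu; rewrite (chart_coordK h2).
rewrite -(near_eq_diff E); last exact: differentiable_comp.
rewrite (diff_comp dF dG').
exact: (congr1 (fun q => 'd (coord c \o G \o param b) (coord b (F q)) _)
  (esym ap')).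
Qed.

End pushforward_chain.

Section chart_field.
Context {R : realType} {d : nat} {T : topologicalType}.
Variables (A : atlas R d T) (hA : smooth_atlas A).

(** A [vfield] needs components in every chart; on [dom a] those in [a] determine the others through
    the Jacobians of the transition maps. *)
Definition chart_field (a : chart A) (xi : 'rV[R]_d -> 'rV[R]_d) : vfield A :=
  fun b p => pushforward idfun a b p (xi (coord a p)).

Lemma chart_fieldE a xi p : dom a p -> chart_field a xi a p = xi (coord a p).
Proof. by move=> ap; rewrite /chart_field pushforward_id. Qed.

(** Compatibility between charts is the chain rule. Smoothness in another chart follows by expanding
    the Jacobian in fixed basis directions. *)
Lemma vector_field_chart_field (W : set T) a xi : open W -> W `<=` dom a ->
  smooth (coord a @` W) xi -> vector_field W (chart_field a xi).
Proof.
move=> oW Wa sxi; split=> [b c p Wp bp cp|b].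
  have ap := Wa _ Wp; rewrite /chart_field.
  by rewrite (pushforward_comp hA hA)//; exact: (transition_differentiable hA).
set O := coord b @` _.
have oO : open O by exact: (image_coord_open hA).
pose sg := coord b \o param a; pose tau := coord a \o param b.
have stau : smooth O tau.
  apply: smooth_subset (transition_smooth hA b a).
  by move=> _ [p [/Wa ap bp] <-]; exists p.
apply: (@smooth_eq _ _ _ O (fun u => \sum_(i < d)
  xi (tau u) 0 i *: 'D_(delta_mx 0 i) sg (tau u))) => //.
  move=> _ [p [Wp bp] <-]; have ap := Wa _ Wp.
  have ds : differentiable sg (coord a p).
    exact: (transition_differentiable hA).
  rewrite /= /chart_field /pushforward /tau/= (chart_coordK hA)// diff_rV.
  by apply: eq_bigr => i _; rewrite deriveE.
have Otau u : O u -> (coord a @` W) (tau u).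
  move=> [p [Wp bp] <-]; exists p => //.
  by rewrite /tau/= (chart_coordK hA).
have Otau' u : O u -> (coord a @` (dom a `&` dom b)) (tau u).
  move=> [p [Wp bp] <-]; exists p; first by split=> //; exact: Wa.
  by rewrite /tau/= (chart_coordK hA).
apply: smooth_sum => // i; apply: smoothZ => //.
  by apply: (smooth_coordf (f := xi \o tau)) => //; exact: smooth_comp Otau _ _.
apply: (smooth_comp (g := 'D_(delta_mx 0 i) sg) oO Otau') => //.
exact/smooth_derive/(transition_smooth hA).
Qed.

End chart_field.

(** * Smoothness of the product and graph atlases *)

Section product_atlas.
Context {R : realType} {d1 d2 : nat} {T1 T2 : topologicalType}.
Variables (A1 : atlas R d1 T1) (A2 : atlas R d2 T2).
Hypotheses (h1 : smooth_atlas A1) (h2 : smooth_atlas A2).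

Lemma continuous_row_mx (T : topologicalType) m p (f : T -> 'rV[R]_m)
    (g : T -> 'rV[R]_p) x :
  {for x, continuous f} -> {for x, continuous g} ->
  {for x, continuous (fun y => row_mx (f y) (g y))}.
Proof.
move=> cf cg.
have -> : (fun y => row_mx (f y) (g y)) =
    (fun y => f y *m row_mx 1%:M 0 + g y *m row_mx 0 1%:M).
  by apply/funext => y; rewrite row_mxE.
have cB k l (h : T -> 'rV[R]_k) (B : 'M[R]_(k, l)) :
    {for x, continuous h} -> {for x, continuous (fun y => h y *m B)}.
  move=> ch; apply: (@continuous_comp _ _ _ h (mulmxr B) x ch).
  exact: (linear_rV_continuous (L := mulmxr B)).
by apply: continuousD; apply: cB.
Qed.

Lemma image_coord_prod (a : chart A1) (b : chart A2) (U1 : set T1) (U2 : set T2) u :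
  (coord (a := prod_atlas A1 A2) (a, b) @` (U1 `*` U2)) u <->
  (coord a @` U1) (lsubmx u) /\ (coord b @` U2) (rsubmx u).
Proof.
split=> [[[p q] [/= Up Uq] <-]|[[p Up pu] [q Uq qu]]].
  by rewrite row_mxKl row_mxKr; split; [exists p|exists q].
by exists (p, q) => //=; rewrite pu qu hsubmxK.
Qed.

Lemma smooth_atlas_prod : smooth_atlas (prod_atlas A1 A2).
Proof.
split; [|split].
- move=> [p q]; have [[+ _] [+ _]] := (h1, h2).
  by move=> /(_ p)[a ap] /(_ q)[b bq]; exists (a, b).
- move=> [a b]; split.
  + apply: (@openI _ (fst @^-1` dom a) (snd @^-1` dom b)); apply: open_comp.
    * by move=> x _; exact: cvg_fst.
    * exact: dom_open.
    * by move=> x _; exact: cvg_snd.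
    * exact: dom_open.
  + have -> : coord (a := prod_atlas A1 A2) (a, b) @`
        dom (a := prod_atlas A1 A2) (a, b) =
        lsubmx @^-1` (coord a @` dom a) `&` rsubmx @^-1` (coord b @` dom b).
      apply/seteqP; split=> u; first by move=> /image_coord_prod.
      by move=> ?; apply/image_coord_prod.
    apply: openI; apply: open_comp => //; try exact: codom_open.
      by move=> u _; exact: continuous_lsubmx.
    by move=> u _; exact: continuous_rsubmx.
  + move=> [p q] [/= ap bq]; rewrite row_mxKl row_mxKr.
    by rewrite (chart_coordK h1)// (chart_coordK h2).
  + move=> [p q] [/= ap bq]; apply: continuous_row_mx.
      apply: (@continuous_comp _ _ _ fst (coord a)); first exact: cvg_fst.
      exact: (coord_continuous_dom h1).
    apply: (@continuous_comp _ _ _ snd (coord b)); first exact: cvg_snd.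
    exact: (coord_continuous_dom h2).
  + move=> u /image_coord_prod[au bu].
    have c1 : {for u, continuous (param a \o @lsubmx R 1 d1 d2)}.
      apply: continuous_comp; first exact: continuous_lsubmx.
      exact: (param_continuous h1).
    have c2 : {for u, continuous (param b \o @rsubmx R 1 d1 d2)}.
      apply: continuous_comp; first exact: continuous_rsubmx.
      exact: (param_continuous h2).
    exact: cvg_pair c1 c2.
- move=> [a b] [a' b'] /=.
  have -> : dom (a := prod_atlas A1 A2) (a, b) `&`
        dom (a := prod_atlas A1 A2) (a', b') =
      (dom a `&` dom a') `*` (dom b `&` dom b').
    by apply/seteqP; split=> -[p q] /= [] [? ?] [? ?].
  set O := _ @` _.
  have oO : open O.
    have -> : O = lsubmx @^-1` (coord a @` (dom a' `&` dom a)) `&`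
        rsubmx @^-1` (coord b @` (dom b' `&` dom b)).
      rewrite (setIC (dom a')) (setIC (dom b')).
      apply/seteqP; split=> u; first by move=> /image_coord_prod.
      by move=> ?; apply/image_coord_prod.
    apply: openI; apply: open_comp.
    - by move=> u _; exact: continuous_lsubmx.
    - by apply: (image_coord_open h1); exact: dom_open h1 _.
    - by move=> u _; exact: continuous_rsubmx.
    - by apply: (image_coord_open h2); exact: dom_open h2 _.
  have Ol u : O u -> (coord a @` (dom a `&` dom a')) (lsubmx u).
    by move=> /image_coord_prod[].
  have Or u : O u -> (coord b @` (dom b `&` dom b')) (rsubmx u).
    by move=> /image_coord_prod[].
  apply: (smooth_row_mx oO).
    apply: (smooth_comp (g := coord a' \o param a) oO Ol).
      by apply: smooth_lsubmx => //; exact: smooth_id.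
    exact: transition_smooth.
  apply: (smooth_comp (g := coord b' \o param b) oO Or).
    by apply: smooth_rsubmx => //; exact: smooth_id.
  exact: transition_smooth.
Qed.

End product_atlas.

Section graph.
Context {R : realType} {d : nat} {M M' : topologicalType}.
Variables (A : atlas R d M) (f : M -> M').
Hypotheses (hA : smooth_atlas A) (cf : continuous f).

Lemma set_val_continuous (T : topologicalType) (S : set T) :
  continuous (set_val : S -> T).
Proof. exact: initial_continuous. Qed.

Lemma graph_pointK (y : graph_set f) : graph_point f (set_val y).1 = y.
Proof.
apply: val_inj; case: y => [[p q] fpq]; have := set_mem fpq.
by rewrite /graph_set/= => <-.
Qed.

Lemma continuous_graph_point : continuous (graph_point f).
Proof.
move=> p B; rewrite nbhsE => -[C [[D oD <-] /= Dp] CB].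
suff : nbhs p ((fun q => (q, f q)) @^-1` D) by apply: filterS => q Dq; exact: CB.
have : {for p, continuous (fun q => (q, f q))}.
  by apply: cvg_pair; [exact: cvg_id|exact: cf].
by apply; exact: open_nbhs_nbhs.
Qed.

(** A chart of the graph has the same coordinate images as the chart of M it comes from, so openness
    and smooth transitions are inherited from M. *)
Lemma image_coord_graph (a : chart A) (U : set (graph_set f)) :
  coord (a := graph_atlas A f) a @` (U `&` dom (a := graph_atlas A f) a) =
  coord a @` (graph_point f @^-1` U `&` dom a).
Proof.
apply/seteqP; split=> u /=.
  by move=> [y [Uy ay] <-]; exists (set_val y).1 => //; split=> //=;
    rewrite graph_pointK.
by move=> [p [Up ap] <-]; exists (graph_point f p).
Qed.

Lemma smooth_atlas_graph : smooth_atlas (graph_atlas A f).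
Proof.
have cfst : continuous (fun y : graph_set f => (set_val y).1).
  by move=> y; apply: (@continuous_comp _ _ _ set_val fst);
    [exact: set_val_continuous|exact: cvg_fst].
split; [|split].
- by move=> y; have [+ _] := hA => /(_ (set_val y).1)[a ay]; exists a.
- move=> a; split.
  + suff : open ((fun y : graph_set f => (set_val y).1) @^-1` dom (a := A) a).
      by [].
    apply: open_comp.
      by move=> y _; exact: cfst.
    exact: dom_open.
  + have := image_coord_graph a setT; rewrite preimage_setT !setTI => ->.
    exact: codom_open.
  + by move=> y ay /=; rewrite (chart_coordK hA)// graph_pointK.
  + move=> y ay; apply: (@continuous_comp _ _ _ (fun y : graph_set f => (set_val y).1)).
      exact: cfst.
    exact: (coord_continuous_dom hA).
  + have := image_coord_graph a setT; rewrite preimage_setT !setTI => -> u au.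
    have c1 : {for u, continuous (graph_point f \o param (a := A) a)}.
      apply: continuous_comp; first exact: (param_continuous hA).
      exact: continuous_graph_point.
    exact: c1.
- move=> a b; rewrite setIC image_coord_graph.
  by rewrite setIC; exact: transition_smooth.
Qed.

End graph.

(** * Higher directional derivatives as multilinear forms *)

Lemma derive_sumE {R : realType} {V W : normedModType R} n (F : 'I_n -> V -> W)
    x v : (forall i, derivable (F i) x v) ->
  'D_v (fun y => \sum_(i < n) F i y) x = \sum_(i < n) 'D_v (F i) x.
Proof.
move=> dF; rewrite -derive_sum//; congr ('D_v _ x).
by apply/funext => y; rewrite fct_sumE.
Qed.

(** Linearity is a hypothesis rather than a bundled structure, because the forms to which this is
    applied are known to be linear only at points of a given open set. *)
Lemma linear_expansion {R : realType} m (L : 'rV[R]_m -> R) u :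
  linear_for *%R L -> L u = \sum_(i < m) u 0 i * L (delta_mx 0 i).
Proof.
move=> hL.
pose LM := GRing.isLinear.Build R 'rV[R]_m R *%R L hL.
pose Lh : {linear 'rV[R]_m -> R | *%R} := HB.pack L LM.
rewrite [LHS](_ : _ = Lh u)// [in LHS](row_sum_delta u) linear_sum.
by apply: eq_bigr => i _; rewrite linearZ.
Qed.

Lemma bilinear_expansion {R : realType} m (B : 'rV[R]_m -> 'rV[R]_m -> R) :
  (forall w, linear_for *%R (B ^~ w)) -> (forall v, linear_for *%R (B v)) ->
  forall v w, B v w = \sum_(i < m) \sum_(j < m)
    v 0 i * w 0 j * B (delta_mx 0 i) (delta_mx 0 j).
Proof.
move=> Bl Br v w.
rewrite (linear_expansion v (Bl w)); apply: eq_bigr => i _.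
rewrite (linear_expansion w (Br _)) mulr_sumr; apply: eq_bigr => j _.
by rewrite mulrA.
Qed.

Lemma sum2_add3 (R : nmodType) m (a b c : 'I_m -> 'I_m -> R) :
  \sum_(i < m) \sum_(j < m) (a i j + (b i j + c i j)) =
  \sum_(i < m) \sum_(j < m) a i j + (\sum_(i < m) \sum_(j < m) b i j +
    \sum_(i < m) \sum_(j < m) c i j).
Proof.
by rewrite -!big_split; apply: eq_bigr => i _; rewrite !big_split.
Qed.

Section higher_derivatives.
Context {R : realType} {m : nat}.
Variables (U : set 'rV[R]_m) (g : 'rV[R]_m -> R).
Hypotheses (oU : open U) (sg : smooth U g).

Definition hess (h : 'rV[R]_m -> R) x v w : R := 'D_v ('D_w h) x.
Definition third (h : 'rV[R]_m -> R) x u v w : R := 'D_u ('D_v ('D_w h)) x.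

Lemma derive_dir_linear (h : 'rV[R]_m -> R) x : differentiable h x ->
  linear_for *%R (fun v => 'D_v h x).
Proof. by move=> dh a v w; rewrite !deriveE// linearP. Qed.

Lemma hessC x v w : U x -> hess g x v w = hess g x w v.
Proof. exact: schwarz. Qed.

Lemma hess_linearl x w : U x -> linear_for *%R (hess g x ^~ w).
Proof.
move=> Ux; apply: derive_dir_linear.
exact: (smooth_differentiable (smooth_derive w sg) Ux).
Qed.

(** Symmetry moves the inner direction to the outer place, where linearity is that of a differential
    at one point. *)
Lemma hess_linearr x v : U x -> linear_for *%R (hess g x v).
Proof.
move=> Ux a w w'; rewrite !(@hessC x v)//.
exact: (hess_linearl v Ux a w w').
Qed.

Lemma third_swap12 x u v w : U x -> third g x u v w = third g x v u w.
Proof. by move=> Ux; apply: (schwarz _ _ oU) Ux; exact: smooth_derive. Qed.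

Lemma third_swap23 x u v w : U x -> third g x u v w = third g x u w v.
Proof.
move=> Ux; apply: near_eq_derive.
by apply: (open_in_near oU Ux) => y Uy; exact: schwarz oU sg Uy.
Qed.

Lemma third_linear1 x v w : U x -> linear_for *%R (fun u => third g x u v w).
Proof.
move=> Ux; apply: derive_dir_linear.
exact: (smooth_differentiable (smooth_derive v (smooth_derive w sg)) Ux).
Qed.

Lemma third_linear2 x u w : U x -> linear_for *%R (fun v => third g x u v w).
Proof.
move=> Ux a v v'; rewrite !(@third_swap12 x u)//.
exact: (third_linear1 u w Ux a v v').
Qed.

Lemma third_linear3 x u v : U x -> linear_for *%R (third g x u v).
Proof.
move=> Ux a w w'; rewrite !(@third_swap23 x u v)//.
exact: (third_linear2 u v Ux a w w').
Qed.

Lemma differentiable_hess (V : normedModType R) (O : set V)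
    (phi f1 f2 : V -> 'rV[R]_m) x : open O -> O x -> (forall y, O y -> U (phi y)) ->
  differentiable phi x -> differentiable f1 x -> differentiable f2 x ->
  differentiable (fun y => hess g (phi y) (f1 y) (f2 y)) x.
Proof.
move=> oO Ox OU dphi df1 df2.
pose e i : 'rV[R]_m := delta_mx 0 i.
have Ux := OU _ Ox.
apply: (@near_eq_differentiable _ _ _ (\sum_(i < m) \sum_(j < m)
    (fun y => f1 y 0 i * f2 y 0 j * hess g (phi y) (e i) (e j)))).
  apply: (open_in_near oO Ox) => y /OU Uy; rewrite fct_sumE.
  apply: esym; apply: etrans (bilinear_expansion (fun w => @hess_linearl _ w Uy)
    (fun w => @hess_linearr _ w Uy) _ _) _.
  by apply: eq_bigr => i _; rewrite fct_sumE.
have dh i j : differentiable (fun z => hess g z (e i) (e j)) (phi x).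
  exact: (smooth_differentiable (smooth_derive (e i) (smooth_derive (e j) sg)) Ux).
do 2!apply: differentiable_sum => ?.
apply: differentiableM (differentiable_comp dphi (dh _ _)).
exact: differentiableM (differentiable_coordf _ df1) (differentiable_coordf _ df2).
Qed.

(** Base point and both directions vary at once. Expansion in the basis turns the directions into
    scalar coefficients, and the three terms are those of a product rule; the chain rule puts
    ['D_v phi x] in the outer slot of [third]. *)
Lemma derive_hess (V : normedModType R) (O : set V) (phi f1 f2 : V -> 'rV[R]_m)
    x v : open O -> O x -> (forall y, O y -> U (phi y)) ->
  differentiable phi x -> differentiable f1 x -> differentiable f2 x ->
  'D_v (fun y => hess g (phi y) (f1 y) (f2 y)) x =
  third g (phi x) ('D_v phi x) (f1 x) (f2 x) +
  (hess g (phi x) ('D_v f1 x) (f2 x) + hess g (phi x) (f1 x) ('D_v f2 x)).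
Proof.
move=> oO Ox OU dphi df1 df2.
pose e i : 'rV[R]_m := delta_mx 0 i.
have Ux := OU _ Ox.
have -> : 'D_v (fun y => hess g (phi y) (f1 y) (f2 y)) x =
    'D_v (fun y => \sum_(i < m) \sum_(j < m)
      f1 y 0 i * f2 y 0 j * hess g (phi y) (e i) (e j)) x.
  apply: near_eq_derive; apply: (open_in_near oO Ox) => y /OU Uy.
  exact: (bilinear_expansion (fun w => @hess_linearl _ w Uy)
    (fun w => @hess_linearr _ w Uy)).
have dh i j : differentiable (fun z => hess g z (e i) (e j)) (phi x).
  exact: (smooth_differentiable (smooth_derive (e i) (smooth_derive (e j) sg)) Ux).
have dhp i j : differentiable (fun y => hess g (phi y) (e i) (e j)) x.
  exact: (differentiable_comp dphi (dh i j)).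
have d1 i := differentiable_coordf i df1.
have d2 j := differentiable_coordf j df2.
have d12 i j : differentiable (fun y => f1 y 0 i * f2 y 0 j) x.
  exact: differentiableM (d1 i) (d2 j).
have d123 i j : differentiable
    (fun y => f1 y 0 i * f2 y 0 j * hess g (phi y) (e i) (e j)) x.
  exact: differentiableM (d12 i j) (dhp i j).
rewrite derive_sumE; last first.
  move=> i; apply: diff_derivable.
  have -> : (fun y => \sum_(j < m) f1 y 0 i * f2 y 0 j *
      hess g (phi y) (e i) (e j)) =
      \sum_(j < m) (fun y => f1 y 0 i * f2 y 0 j * hess g (phi y) (e i) (e j)).
    by apply/funext => y; rewrite fct_sumE.
  exact: differentiable_sum.
have E i j : 'D_v (fun y => f1 y 0 i * f2 y 0 j *
      hess g (phi y) (e i) (e j)) x =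
    f1 x 0 i * f2 x 0 j * third g (phi x) ('D_v phi x) (e i) (e j) +
    ('D_v f1 x 0 i * f2 x 0 j * hess g (phi x) (e i) (e j) +
     f1 x 0 i * 'D_v f2 x 0 j * hess g (phi x) (e i) (e j)).
  rewrite [LHS](deriveM (diff_derivable (d12 i j)) (diff_derivable (dhp i j))).
  rewrite (deriveM (diff_derivable (d1 i)) (diff_derivable (d2 j))).
  rewrite !derive_coordf//.
  have -> : 'D_v (fun y => hess g (phi y) (e i) (e j)) x =
      third g (phi x) ('D_v phi x) (e i) (e j).
    exact: (derive_comp v dphi (dh i j)).
  rewrite /GRing.scale/=; ring.
have Es i : 'D_v (fun y => \sum_(j < m) f1 y 0 i * f2 y 0 j *
      hess g (phi y) (e i) (e j)) x =
    \sum_(j < m) (f1 x 0 i * f2 x 0 j * third g (phi x) ('D_v phi x) (e i) (e j) +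
    ('D_v f1 x 0 i * f2 x 0 j * hess g (phi x) (e i) (e j) +
     f1 x 0 i * 'D_v f2 x 0 j * hess g (phi x) (e i) (e j))).
  rewrite derive_sumE; last by move=> j; exact: diff_derivable.
  by apply: eq_bigr => j _; exact: E.
rewrite (eq_bigr _ (fun i _ => Es i)).
rewrite (bilinear_expansion (fun w => @third_linear2 _ _ w Ux)
  (fun w => @third_linear3 _ _ w Ux)).
rewrite !(bilinear_expansion (fun w => @hess_linearl _ w Ux)
  (fun w => @hess_linearr _ w Ux)).
exact: sum2_add3.
Qed.
End higher_derivatives.

Section partial_derivatives.
Context {R : realType} {m p : nat} {W : normedModType R}.
Variable g : 'rV[R]_(m + p) -> W.

(** The two difference quotients are the same function, so the identity holds whether or not the
    limit exists, and [mixed_hessianE] can be stated at every u and w. *)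
Lemma derive_row_mxl u w v :
  'D_v (fun u' => g (row_mx u' w)) u = 'D_(row_mx v 0) g (row_mx u w).
Proof.
pose quot k (f : 'rV[R]_k -> W) x y (h : R) :=
  h^-1 *: ((f \o shift x) (h *: y) - f x).
suff E : quot _ (fun u' => g (row_mx u' w)) u v = quot _ g (row_mx u w) (row_mx v 0).
  exact: (congr1 (fun q => lim (q @ 0^')) E).
apply/funext => h.
by rewrite /quot /= scale_row_mx add_row_mx scaler0 add0r.
Qed.

Lemma derive_row_mxr u w v :
  'D_v (fun w' => g (row_mx u w')) w = 'D_(row_mx 0 v) g (row_mx u w).
Proof.
pose quot k (f : 'rV[R]_k -> W) x y (h : R) :=
  h^-1 *: ((f \o shift x) (h *: y) - f x).
suff E : quot _ (fun w' => g (row_mx u w')) w v = quot _ g (row_mx u w) (row_mx 0 v).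
  exact: (congr1 (fun q => lim (q @ 0^')) E).
apply/funext => h.
by rewrite /quot /= scale_row_mx add_row_mx scaler0 add0r.
Qed.

End partial_derivatives.

(** * Koszul's formula and the Levi-Civita connection of the cost metric *)

Section koszul_algebra.
Context {R : realFieldType} {V : lmodType R}.

(* At a point where Z has constant components: n.. are covariant derivatives,
   d.. derivatives of components, and t1, t2, t3 the derivatives of the
   coefficients of h. *)
Lemma koszul (h : V -> V -> R) (v w z nXY nYX nXZ nZX nYZ nZY dXY dYX dZX dZY : V)
    (t1 t2 t3 : R) :
  (forall x, linear_for *%R (h x)) -> (forall x y, h x y = h y x) ->
  nXY - nYX = dXY - dYX -> nXZ - nZX = - dZX -> nYZ - nZY = - dZY ->
  t1 + h dXY z = h nXY z + h w nXZ ->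
  t2 + h dYX z = h nYX z + h v nYZ ->
  t3 + (h dZX w + h v dZY) = h nZX w + h v nZY ->
  2 * h nXY z = 2 * h dXY z + (t1 + t2 - t3).
Proof.
move=> hl hC EXY EXZ EYZ.
have hD x y y' : h x (y + y') = h x y + h x y'.
  by have := hl x 1 y y'; rewrite scale1r mul1r.
have hN x y : h x (- y) = - h x y.
  have h0 : h x 0 = 0.
    by have := hD x 0 0; rewrite addr0 => /eqP;
      rewrite -subr_eq0 opprD addNKr oppr_eq0 => /eqP.
  by have := hl x (-1) y 0; rewrite scaleN1r addr0 h0 addr0 mulN1r.
(* Paired with z, w and v, the three torsion identities become scalar; the claim is a linear
   combination of these and the three metric identities. *)
have := congr1 (h z) EXY; have := congr1 (h w) EXZ; have := congr1 (h v) EYZ.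
rewrite !hD !hN (hC nXY) (hC dXY) (hC nYX) (hC dYX) (hC dZX) (hC nZX).
lra.
Qed.
End koszul_algebra.

Section cost_connection.
Context {R : realType} {n : nat} {M M' : topologicalType}.
Variables (A : atlas R n M) (A' : atlas R n M') (c : M -> M' -> R).
Hypotheses (hA : smooth_atlas A) (hA' : smooth_atlas A').
Hypothesis c_smooth : smooth_cost A A' c.
Variables (a : chart A) (b : chart A').

Local Notation AP := (prod_atlas A A').
Local Notation ab := ((a, b) : chart AP).
Let hAP : smooth_atlas AP := smooth_atlas_prod hA hA'.

Definition cost_coord (z : 'rV[R]_(n + n)) : R :=
  c (param a (lsubmx z)) (param b (rsubmx z)).

(** The intersection with [setT] copies the shape of [smooth_fun], so that [cost_coord_smooth] is
    the smoothness hypothesis itself. *)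
Definition cost_dom : set 'rV[R]_(n + n) := coord ab @` (setT `&` dom ab).

Lemma cost_dom_open : open cost_dom.
Proof. by apply: (image_coord_open hAP); exact: openT. Qed.

Lemma cost_coord_smooth : smooth cost_dom cost_coord.
Proof. exact: c_smooth. Qed.

Lemma cost_dom_mem p q : dom a p -> dom b q ->
  cost_dom (row_mx (coord a p) (coord b q)).
Proof. by move=> ap bq; exists (p, q). Qed.

(** Iterated partial derivatives in separate variables become one second derivative of a function on
    the product chart, to which the symmetry and linearity lemmas apply. *)
Lemma mixed_hessianE u w i j : mixed_hessian c a b u w i j =
  hess cost_coord (row_mx u w) (row_mx (delta_mx 0 i) 0)
    (row_mx 0 (delta_mx 0 j)).
Proof.
rewrite /mixed_hessian mxE.
have E : (fun u' => partial j (fun w' => c (param a u') (param b w')) w) =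
    (fun u' => 'D_(row_mx 0 (delta_mx 0 j)) cost_coord (row_mx u' w)).
  apply/funext => u'; apply: etrans (derive_row_mxr cost_coord u' w _).
  apply: (congr1 (fun F => 'D_(delta_mx 0 j) F w)).
  by apply/funext => w'; rewrite /cost_coord row_mxKl row_mxKr.
apply: etrans (congr1 (fun F => partial i F u) E) _.
exact: (derive_row_mxl ('D_(row_mx 0 (delta_mx 0 j)) cost_coord) u w).
Qed.

Definition mixed z (v w : 'rV[R]_n) : R :=
  hess cost_coord z (row_mx v 0) (row_mx 0 w).

Lemma row_mxPl k l (s : R) (v v' : 'rV[R]_k) :
  row_mx (s *: v + v') (0 : 'rV[R]_l) = s *: row_mx v 0 + row_mx v' 0.
Proof. by rewrite scale_row_mx add_row_mx scaler0 addr0. Qed.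

Lemma row_mxPr k l (s : R) (v v' : 'rV[R]_k) :
  row_mx (0 : 'rV[R]_l) (s *: v + v') = s *: row_mx 0 v + row_mx 0 v'.
Proof. by rewrite scale_row_mx add_row_mx scaler0 addr0. Qed.

Lemma mixed_linearl z w : cost_dom z -> linear_for *%R (mixed z ^~ w).
Proof.
move=> Uz s v v'; rewrite /mixed row_mxPl.
exact: (hess_linearl cost_coord_smooth (row_mx 0 w) Uz).
Qed.

Lemma mixed_linearr z v : cost_dom z -> linear_for *%R (mixed z v).
Proof.
move=> Uz s w w'; rewrite /mixed row_mxPr.
exact: (hess_linearr cost_dom_open cost_coord_smooth (row_mx v 0) Uz).
Qed.

Lemma mixedDl z v v' w : cost_dom z ->
  mixed z (v + v') w = mixed z v w + mixed z v' w.
Proof.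
by move=> Uz; have := mixed_linearl w Uz 1 v v'; rewrite scale1r mul1r.
Qed.

Lemma mixedDr z v w w' : cost_dom z ->
  mixed z v (w + w') = mixed z v w + mixed z v w'.
Proof.
by move=> Uz; have := mixed_linearr v Uz 1 w w'; rewrite scale1r mul1r.
Qed.

Lemma mixed0l z w : cost_dom z -> mixed z 0 w = 0.
Proof.
by move=> Uz; have := mixed_linearl w Uz (-1) 0 0;
  rewrite scaler0 addr0 mulN1r addNr.
Qed.

Lemma mixed0r z v : cost_dom z -> mixed z v 0 = 0.
Proof.
by move=> Uz; have := mixed_linearr v Uz (-1) 0 0;
  rewrite scaler0 addr0 mulN1r addNr.
Qed.

Lemma mixed_mixed_hessian p q v w : dom a p -> dom b q ->
  mixed (row_mx (coord a p) (coord b q)) v w =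
  \sum_i \sum_j mixed_hessian c a b (coord a p) (coord b q) i j *
    v 0 i * w 0 j.
Proof.
move=> ap bq; have Uz := cost_dom_mem ap bq.
rewrite (bilinear_expansion (fun w => mixed_linearl w Uz)
  (fun w => mixed_linearr w Uz)).
apply: eq_bigr => i _; apply: eq_bigr => j _.
by rewrite mixed_hessianE mulrC mulrA.
Qed.

(** Polarization leaves the cross terms only: h has no block inside either factor. *)
Lemma cost_metricE p q v w : dom a p -> dom b q ->
  cost_metric A A' c ab (p, q) v w =
  - 2^-1 * (mixed (coord ab (p, q)) (lsubmx v) (rsubmx w) +
            mixed (coord ab (p, q)) (lsubmx w) (rsubmx v)).
Proof.
move=> ap bq; have Uz := cost_dom_mem ap bq.
rewrite /cost_metric /cost_quad /= -!mixed_mixed_hessian//.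
rewrite [lsubmx (v + w)]linearD [rsubmx (v + w)]linearD.
rewrite mixedDl// !mixedDr//.
move: (mixed _ _ _) (mixed _ _ _) (mixed _ _ _) (mixed _ _ _) => x y s t.
by ring.
Qed.

Definition cost_metric_deriv z (u v w : 'rV[R]_(n + n)) : R :=
  - 2^-1 * (third cost_coord z u (row_mx (lsubmx v) 0) (row_mx 0 (rsubmx w)) +
            third cost_coord z u (row_mx (lsubmx w) 0) (row_mx 0 (rsubmx v))).

End cost_connection.

Lemma product_rule_arith (R : comNzRingType) (k t1 t2 a1 a2 b1 b2 : R) :
  k * (t1 + (a1 + b1) + (t2 + (a2 + b2))) =
  k * (t1 + t2) + (k * (a1 + b2) + k * (b1 + a2)).
Proof. ring. Qed.

Section metric_derivative.
Context {R : realType} {n : nat} {M M' : topologicalType}.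
Variables (A : atlas R n M) (A' : atlas R n M') (c : M -> M' -> R).
Hypotheses (hA : smooth_atlas A) (hA' : smooth_atlas A').
Hypothesis c_smooth : smooth_cost A A' c.
Variables (a : chart A) (b : chart A').

Local Notation AP := (prod_atlas A A').
Local Notation ab := ((a, b) : chart AP).
Let hAP : smooth_atlas AP := smooth_atlas_prod hA hA'.
Local Notation cc := (cost_coord c a b).
Local Notation U := (cost_dom a b).
Let oU : open U := @cost_dom_open _ _ _ _ _ _ hA hA' a b.
Let sc : smooth U cc := @cost_coord_smooth _ _ _ _ _ _ _ c_smooth a b.

Lemma differentiable_mixed (V : normedModType R) (O : set V)
    (phi : V -> 'rV[R]_(n + n)) (f1 f2 : V -> 'rV[R]_n) x :
  open O -> O x -> (forall y, O y -> U (phi y)) ->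
  differentiable phi x -> differentiable f1 x -> differentiable f2 x ->
  differentiable (fun y => mixed c a b (phi y) (f1 y) (f2 y)) x.
Proof.
move=> oO Ox OU dphi df1 df2.
apply: (differentiable_hess oU sc oO Ox OU dphi).
  exact: differentiable_row_mx df1 (differentiable_cst _ _).
exact: differentiable_row_mx (differentiable_cst _ _) df2.
Qed.

Lemma derive_mixed (V : normedModType R) (O : set V)
    (phi : V -> 'rV[R]_(n + n)) (f1 f2 : V -> 'rV[R]_n) x v dphix df1x df2x :
  open O -> O x -> (forall y, O y -> U (phi y)) ->
  differentiable phi x -> differentiable f1 x -> differentiable f2 x ->
  'D_v phi x = dphix -> 'D_v f1 x = df1x -> 'D_v f2 x = df2x ->
  'D_v (fun y => mixed c a b (phi y) (f1 y) (f2 y)) x =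
  third cc (phi x) dphix (row_mx (f1 x) 0) (row_mx 0 (f2 x)) +
  (mixed c a b (phi x) df1x (f2 x) + mixed c a b (phi x) (f1 x) df2x).
Proof.
move=> oO Ox OU dphi df1 df2 <- <- <-; have d0 := @differentiable_cst R V 'rV[R]_n 0 x.
apply: etrans (derive_hess oU sc v oO Ox OU dphi
  (differentiable_row_mx df1 d0) (differentiable_row_mx d0 df2)) _.
have -> := derive_row_mx v df1 d0; have -> := derive_row_mx v d0 df2.
by rewrite derive_cst.
Qed.

Lemma derive_lsubmx (V : normedModType R) (f : V -> 'rV[R]_(n + n)) x v :
  differentiable f x ->
  differentiable (fun y => lsubmx (f y)) x /\
  'D_v (fun y => lsubmx (f y)) x = lsubmx ('D_v f x).
Proof.
move=> df; have -> : (fun y => lsubmx (f y)) = (fun y => f y *m col_mx 1%:M 0).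
  by apply/funext => y; rewrite lsubmxE.
rewrite lsubmxE; split; first exact: differentiable_mulmxr.
exact: derive_mulmxr.
Qed.

Lemma derive_rsubmx (V : normedModType R) (f : V -> 'rV[R]_(n + n)) x v :
  differentiable f x ->
  differentiable (fun y => rsubmx (f y)) x /\
  'D_v (fun y => rsubmx (f y)) x = rsubmx ('D_v f x).
Proof.
move=> df; have -> : (fun y => rsubmx (f y)) = (fun y => f y *m col_mx 0 1%:M).
  by apply/funext => y; rewrite rsubmxE.
rewrite rsubmxE; split; first exact: differentiable_mulmxr.
exact: derive_mulmxr.
Qed.

(** The metric axiom of [levi_civita] differentiates h(Y, Z) as a whole; Koszul's formula wants the
    derivative of the coefficients apart from those of the components. *)
Lemma dir_cost_metric (W : set (M * M')) (X Y Z : vfield AP) p q :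
  open W -> vector_field W Y -> vector_field W Z ->
  W (p, q) -> dom a p -> dom b q ->
  dir (W := R^o) X (fun e y => cost_metric A A' c e y (Y e y) (Z e y)) ab (p, q) =
  cost_metric_deriv c a b (coord ab (p, q)) (X ab (p, q)) (Y ab (p, q)) (Z ab (p, q))
  + (cost_metric A A' c ab (p, q) (dir X Y ab (p, q)) (Z ab (p, q)) +
     cost_metric A A' c ab (p, q) (Y ab (p, q)) (dir X Z ab (p, q))).
Proof.
move=> oW vY vZ Wx ap bq; set z := coord ab (p, q).
set v := X ab (p, q).
pose y u := Y ab (param ab u); pose w u := Z ab (param ab u).
have abx : dom ab (p, q) by [].
pose O := coord ab @` (W `&` dom ab).
have oO : open O by exact: (image_coord_open hAP).
have Oz : O z by exact: image_coord_mem.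
have OU u : O u -> U u by move=> [x [_ abx'] <-]; exists x.
have dy : differentiable y z by exact: (smooth_differentiable (vY.2 ab)).
have dw : differentiable w z by exact: (smooth_differentiable (vZ.2 ab)).
have did : differentiable (id : 'rV[R]_(n + n) -> _) z by apply: ex_diff.
(* Near z this is -2 h(Y, Z) read in the chart. *)
pose G (u : 'rV[R]_(n + n)) : R :=
  mixed c a b u (lsubmx (y u)) (rsubmx (w u)) +
  mixed c a b u (lsubmx (w u)) (rsubmx (y u)).
have [dyl Dyl] := derive_lsubmx v dy; have [dyr Dyr] := derive_rsubmx v dy.
have [dwl Dwl] := derive_lsubmx v dw; have [dwr Dwr] := derive_rsubmx v dw.
have dG1 := differentiable_mixed oO Oz OU did dyl dwr.
have dG2 := differentiable_mixed oO Oz OU did dwl dyr.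
have dG : differentiable G z by exact: differentiableD dG1 dG2.
have E : \forall u \near z, - 2^-1 * G u =
    ((fun x => cost_metric A A' c ab x (Y ab x) (Z ab x)) \o param ab) u.
  apply: filterS (near_image_coord hAP oW Wx abx) => u [uK [au bu] Wu].
  exact: (esym (etrans (cost_metricE hA hA' c_smooth (y u) (w u) au bu)
    (congr1 (fun z => - 2^-1 * (mixed c a b z (lsubmx (y u)) (rsubmx (w u)) +
      mixed c a b z (lsubmx (w u)) (rsubmx (y u)))) uK))).
have dG' : differentiable (fun u => - 2^-1 * G u) z.
  exact: (differentiableZ (- 2^-1) dG).
rewrite /dir -(near_eq_diff E dG') -deriveE//.
have -> : 'D_v (fun u => - 2^-1 * G u) z = - 2^-1 * 'D_v G z.
  exact: (deriveZ (- 2^-1) (diff_derivable dG)).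
have Did : 'D_v id z = v by exact: derive_id.
have E1 := derive_mixed oO Oz OU did dyl dwr Did Dyl Dwr.
have E2 := derive_mixed oO Oz OU did dwl dyr Did Dwl Dyr.
have DG : 'D_v G z = _ := deriveD (diff_derivable dG1) (diff_derivable dG2).
apply: etrans (congr1 (fun r => - 2^-1 * r)
  (etrans DG (f_equal2 (fun r s => r + s) E1 E2))) _.
have yz : y z = Y ab (p, q) by rewrite /y (chart_coordK hAP).
have wz : w z = Z ab (p, q) by rewrite /w (chart_coordK hAP).
have HY := etrans
  (congr1 (fun d => cost_metric A A' c ab (p, q) d (Z ab (p, q)))
    (dirE X vY Wx abx))
  (cost_metricE hA hA' c_smooth ('D_v y z) (Z ab (p, q)) ap bq).
have HZ := etrans
  (congr1 (fun d => cost_metric A A' c ab (p, q) (Y ab (p, q)) d)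
    (dirE X vZ Wx abx))
  (cost_metricE hA hA' c_smooth (Y ab (p, q)) ('D_v w z) ap bq).
apply: etrans _ (esym (f_equal2 (fun r s => cost_metric_deriv c a b z v
  (Y ab (p, q)) (Z ab (p, q)) + (r + s)) HY HZ)).
rewrite /cost_metric_deriv yz wz -/z.
exact: product_rule_arith.
Qed.
End metric_derivative.

(** Here d1, d2, d3 are the derivatives of h in Koszul's formula. The third derivative t1 of the
    cost has two directions in M, while t2 and t3 have one each; only t1 survives in d1 + d2 - d3.
    In the companion below the survivor is t2, with two directions in M'. *)
Lemma koszul_arith_l (R : realFieldType) (h1 h2 d1 d2 d3 A B t1 t2 t3 : R) :
  h1 = - 2^-1 * A -> h2 = - 2^-1 * B -> d1 = - 2^-1 * (t1 + t2) ->
  d2 = - 2^-1 * (t1 + t3) -> d3 = - 2^-1 * (t3 + t2) ->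
  2 * h1 = 2 * h2 + (d1 + d2 - d3) -> A = B + t1.
Proof. by move=> -> -> -> -> ->; lra. Qed.

Lemma koszul_arith_r (R : realFieldType) (h1 h2 d1 d2 d3 A B t1 t2 t3 : R) :
  h1 = - 2^-1 * A -> h2 = - 2^-1 * B -> d1 = - 2^-1 * (t1 + t2) ->
  d2 = - 2^-1 * (t3 + t2) -> d3 = - 2^-1 * (t1 + t3) ->
  2 * h1 = 2 * h2 + (d1 + d2 - d3) -> A = B + t2.
Proof. by move=> -> -> -> -> ->; lra. Qed.

Section levi_civita_cost.
Context {R : realType} {n : nat} {M M' : topologicalType}.
Variables (A : atlas R n M) (A' : atlas R n M') (c : M -> M' -> R).
Hypotheses (hA : smooth_atlas A) (hA' : smooth_atlas A').
Hypothesis c_smooth : smooth_cost A A' c.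
Variables (a : chart A) (b : chart A').

Local Notation AP := (prod_atlas A A').
Local Notation ab := ((a, b) : chart AP).
Let hAP : smooth_atlas AP := smooth_atlas_prod hA hA'.
Local Notation cc := (cost_coord c a b).
Local Notation U := (cost_dom a b).
Let oU : open U := @cost_dom_open _ _ _ _ _ _ hA hA' a b.
Let sc : smooth U cc := @cost_coord_smooth _ _ _ _ _ _ _ c_smooth a b.

Lemma cost_metricC p q v w : dom a p -> dom b q ->
  cost_metric A A' c ab (p, q) v w = cost_metric A A' c ab (p, q) w v.
Proof.
move=> ap bq; apply: etrans (cost_metricE hA hA' c_smooth v w ap bq) _.
apply: etrans _ (esym (cost_metricE hA hA' c_smooth w v ap bq)).
exact: (congr1 (fun r => - 2^-1 * r) (addrC _ _)).
Qed.

Lemma cost_metric_linear p q v : dom a p -> dom b q ->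
  linear_for *%R (cost_metric A A' c ab (p, q) v).
Proof.
move=> ap bq s w w'; have Uz := cost_dom_mem ap bq.
apply: etrans (cost_metricE hA hA' c_smooth v _ ap bq) _.
apply: etrans _ (esym (f_equal2 (fun x y => s * x + y)
  (cost_metricE hA hA' c_smooth v w ap bq)
  (cost_metricE hA hA' c_smooth v w' ap bq))).
have -> := linearP (@lsubmx R 1 n n) s w w'.
have -> := linearP (@rsubmx R 1 n n) s w w'.
have -> := mixed_linearr hA hA' c_smooth (lsubmx v) Uz s (rsubmx w) (rsubmx w').
have -> := mixed_linearl c_smooth (rsubmx v) Uz s (lsubmx w) (lsubmx w').
move: (mixed _ _ _ _ _ _) (mixed _ _ _ _ _ _) (mixed _ _ _ _ _ _)
  (mixed _ _ _ _ _ _) => x1 x2 x3 x4.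
by ring.
Qed.

Lemma dir_chart_field_cst z0 (X : vfield AP) (W : set (M * M')) p q :
  dom a p -> dom b q -> dir X (chart_field ab (cst z0)) ab (p, q) = 0.
Proof.
move=> ap bq; have abx : dom ab (p, q) by [].
have E : \forall u \near coord ab (p, q),
    cst z0 u = (chart_field ab (cst z0) ab \o param ab) u.
  have := near_image_coord hAP (U := setT) openT (I : setT (p, q)) abx.
  by apply: filterS => u [_ au _]; rewrite /= chart_fieldE.
by rewrite /dir -(near_eq_diff E (differentiable_cst _ _)) diff_cst.
Qed.

Variable nabbar : vfield AP -> vfield AP -> vfield AP.
Hypothesis LC : levi_civita (cost_metric A A' c) nabbar.

(** With a test field constant in the chart, every derivative of components other than [dir X Y]
    vanishes or cancels. *)
Lemma koszul_cost (W : set (M * M')) (X Y : vfield AP) p q z0 :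
  open W -> vector_field W X -> vector_field W Y -> W (p, q) ->
  dom a p -> dom b q ->
  2 * cost_metric A A' c ab (p, q) (nabbar X Y ab (p, q)) z0 =
  2 * cost_metric A A' c ab (p, q) (dir X Y ab (p, q)) z0 +
  (cost_metric_deriv c a b (coord ab (p, q)) (X ab (p, q)) (Y ab (p, q)) z0 +
   cost_metric_deriv c a b (coord ab (p, q)) (Y ab (p, q)) (X ab (p, q)) z0 -
   cost_metric_deriv c a b (coord ab (p, q)) z0 (X ab (p, q)) (Y ab (p, q))).
Proof.
move=> oW vX0 vY0 Wx0 ap bq; have abx : dom ab (p, q) by [].
(* The constant field lives on the domain of the chart only; the axioms of [levi_civita] are used on
   the smaller open set W'. *)
pose W' := W `&` dom ab; pose Z := chart_field ab (cst z0).
have oW' : open W' by apply: openI => //; exact: dom_open.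
have W'W : W' `<=` W by move=> x [].
have Wx : W' (p, q) by [].
have vX := vector_field_subset W'W vX0.
have vY := vector_field_subset W'W vY0.
have vZ : vector_field W' Z.
  apply: vector_field_chart_field => //; first by move=> x [].
  exact: smooth_cst.
have Zz : Z ab (p, q) = z0 by exact: chart_fieldE.
have dZ0 V : dir V Z ab (p, q) = 0 by exact: dir_chart_field_cst.
have [_ tors metr] := LC.
have h0 v : cost_metric A A' c ab (p, q) v 0 = 0.
  have := cost_metric_linear v ap bq (-1) 0 0.
  by rewrite scaler0 addr0 mulN1r addNr.
have T V V' : vector_field W' V -> vector_field W' V' ->
    nabbar V V' ab (p, q) - nabbar V' V ab (p, q) =
    dir V V' ab (p, q) - dir V' V ab (p, q).
  by move=> vV vV'; exact: (tors W' V V' oW' vV vV' ab (p, q) Wx abx).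
have TZ V : vector_field W' V ->
    nabbar V Z ab (p, q) - nabbar Z V ab (p, q) = - dir Z V ab (p, q).
  move=> vV; apply: etrans (T V Z vV vZ) _.
  by rewrite [X in X - _]dZ0 sub0r.
have K V1 V2 V3 : vector_field W' V1 -> vector_field W' V2 ->
    vector_field W' V3 ->
    cost_metric_deriv c a b (coord ab (p, q)) (V1 ab (p, q)) (V2 ab (p, q)) (V3 ab (p, q))
    + (cost_metric A A' c ab (p, q) (dir V1 V2 ab (p, q)) (V3 ab (p, q)) +
       cost_metric A A' c ab (p, q) (V2 ab (p, q)) (dir V1 V3 ab (p, q))) =
    cost_metric A A' c ab (p, q) (nabbar V1 V2 ab (p, q)) (V3 ab (p, q)) +
    cost_metric A A' c ab (p, q) (V2 ab (p, q)) (nabbar V1 V3 ab (p, q)).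
  move=> v1 v2 v3; apply: etrans _ (metr W' V1 V2 V3 oW' v1 v2 v3 ab (p, q) Wx abx).
  apply: esym.
  exact: (dir_cost_metric hA hA' c_smooth V1 oW' v2 v3 Wx ap bq).
have KXY V1 V2 : vector_field W' V1 -> vector_field W' V2 ->
    cost_metric_deriv c a b (coord ab (p, q)) (V1 ab (p, q)) (V2 ab (p, q)) z0
    + cost_metric A A' c ab (p, q) (dir V1 V2 ab (p, q)) z0 =
    cost_metric A A' c ab (p, q) (nabbar V1 V2 ab (p, q)) z0 +
    cost_metric A A' c ab (p, q) (V2 ab (p, q)) (nabbar V1 Z ab (p, q)).
  move=> v1 v2; have := K V1 V2 Z v1 v2 vZ.
  have E0 : cost_metric A A' c ab (p, q) (V2 ab (p, q)) (dir V1 Z ab (p, q)) = 0.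
    exact: etrans (congr1 _ (dZ0 V1)) (h0 _).
  by rewrite E0 addr0 Zz.
have := K Z X Y vZ vX vY; rewrite Zz => KZ.
exact: (koszul (fun v => cost_metric_linear v ap bq)
  (fun v w => cost_metricC v w ap bq) (T X Y vX vY) (TZ X vX) (TZ Y vY)
  (KXY X Y vX vY) (KXY Y X vY vX) KZ).
Qed.

Local Notation L v := (row_mx v (0 : 'rV[R]_n) : 'rV[R]_(n + n)).
Local Notation Rr v := (row_mx (0 : 'rV[R]_n) v : 'rV[R]_(n + n)).

Lemma third_swap13 z u v w : U z -> third cc z u v w = third cc z w v u.
Proof.
move=> Uz; apply: etrans (third_swap12 oU sc u v w Uz) _.
apply: etrans (third_swap23 oU sc v u w Uz) _.
exact: (third_swap12 oU sc v w u Uz).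
Qed.

Lemma thirdD1 z u v w : U z -> third cc z u v w =
  third cc z (L (lsubmx u)) v w + third cc z (Rr (rsubmx u)) v w.
Proof.
move=> Uz; have := third_linear1 sc v w Uz 1 (L (lsubmx u)) (Rr (rsubmx u)).
by rewrite scale1r add_row_mx addr0 add0r hsubmxK mul1r.
Qed.

Lemma third02 z u w : U z -> third cc z u 0 w = 0.
Proof.
move=> Uz; have := third_linear2 oU sc u w Uz (-1) 0 0.
by rewrite scaler0 addr0 mulN1r addNr.
Qed.

Lemma third03 z u w : U z -> third cc z u w 0 = 0.
Proof.
move=> Uz; have := third_linear3 oU sc u w Uz (-1) 0 0.
by rewrite scaler0 addr0 mulN1r addNr.
Qed.

Lemma third_L0 z u w : U z -> third cc z u (L 0) w = 0.
Proof. by move=> Uz; rewrite row_mx0; exact: third02. Qed.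

Lemma third_R0 z u w : U z -> third cc z u w (Rr 0) = 0.
Proof. by move=> Uz; rewrite row_mx0; exact: third03. Qed.

(** Of the two polarized terms one contains the zero M-block of (0, w) and vanishes; the other
    splits along the blocks of the direction u. *)
Lemma cost_metric_deriv_r z u v w : U z ->
  cost_metric_deriv c a b z u v (Rr w) =
  - 2^-1 * (third cc z (L (lsubmx u)) (L (lsubmx v)) (Rr w) +
            third cc z (Rr (rsubmx u)) (L (lsubmx v)) (Rr w)).
Proof.
move=> Uz; rewrite /cost_metric_deriv row_mxKl row_mxKr.
exact: (congr1 (fun r => - 2^-1 * r) (etrans
  (f_equal2 (fun r s => r + s) (thirdD1 u _ _ Uz) (third_L0 _ _ Uz)) (addr0 _))).
Qed.

Lemma cost_metric_deriv_l z u v w : U z ->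
  cost_metric_deriv c a b z u v (L w) =
  - 2^-1 * (third cc z (L (lsubmx u)) (L w) (Rr (rsubmx v)) +
            third cc z (Rr (rsubmx u)) (L w) (Rr (rsubmx v))).
Proof.
move=> Uz; rewrite /cost_metric_deriv row_mxKl row_mxKr.
exact: (congr1 (fun r => - 2^-1 * r) (etrans
  (f_equal2 (fun r s => r + s) (third_R0 _ _ Uz) (thirdD1 u _ _ Uz)) (add0r _))).
Qed.

(** Kept as an identity of pairings instead of being solved for the component, because
    [primal_vector] only tests it on derivatives of F. *)
Lemma levi_civita_costl (W : set (M * M')) (X Y : vfield AP) p q beta :
  open W -> vector_field W X -> vector_field W Y -> W (p, q) ->
  dom a p -> dom b q ->
  mixed c a b (coord ab (p, q)) (lsubmx (nabbar X Y ab (p, q))) beta =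
  mixed c a b (coord ab (p, q)) (lsubmx (dir X Y ab (p, q))) beta +
  third cc (coord ab (p, q)) (L (lsubmx (X ab (p, q))))
    (L (lsubmx (Y ab (p, q)))) (Rr beta).
Proof.
move=> oW vX vY Wx ap bq; have Uz := cost_dom_mem ap bq.
set z := coord ab (p, q); set x := X ab (p, q); set y := Y ab (p, q).
have hR v : cost_metric A A' c ab (p, q) v (Rr beta) =
    - 2^-1 * mixed c a b z (lsubmx v) beta.
  apply: etrans (cost_metricE hA hA' c_smooth v (Rr beta) ap bq) _.
  rewrite row_mxKl row_mxKr; congr (_ * _).
  by rewrite (mixed0l c_smooth _ Uz) addr0.
apply: (koszul_arith_l (hR _) (hR _) (cost_metric_deriv_r x y beta Uz) _ _
  (koszul_cost (Rr beta) oW vX vY Wx ap bq)).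
  apply: etrans (cost_metric_deriv_r y x beta Uz) _.
  exact: (congr1 (fun r => - 2^-1 * (r + _)) (third_swap12 oU sc _ _ _ Uz)).
exact: (congr1 (fun r => - 2^-1 * r) (f_equal2 (fun r s => r + s)
  (third_swap13 _ _ _ Uz) (third_swap13 _ _ _ Uz))).
Qed.

Lemma levi_civita_costr (W : set (M * M')) (X Y : vfield AP) p q alpha :
  open W -> vector_field W X -> vector_field W Y -> W (p, q) ->
  dom a p -> dom b q ->
  mixed c a b (coord ab (p, q)) alpha (rsubmx (nabbar X Y ab (p, q))) =
  mixed c a b (coord ab (p, q)) alpha (rsubmx (dir X Y ab (p, q))) +
  third cc (coord ab (p, q)) (Rr (rsubmx (X ab (p, q))))
    (Rr (rsubmx (Y ab (p, q)))) (L alpha).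
Proof.
move=> oW vX vY Wx ap bq; have Uz := cost_dom_mem ap bq.
set z := coord ab (p, q); set x := X ab (p, q); set y := Y ab (p, q).
have hR v : cost_metric A A' c ab (p, q) v (L alpha) =
    - 2^-1 * mixed c a b z alpha (rsubmx v).
  apply: etrans (cost_metricE hA hA' c_smooth v (L alpha) ap bq) _.
  rewrite row_mxKl row_mxKr; congr (_ * _).
  by rewrite (mixed0r hA hA' c_smooth _ Uz) add0r.
apply: (koszul_arith_r (hR _) (hR _) _ _ _
  (koszul_cost (L alpha) oW vX vY Wx ap bq)).
- apply: etrans (cost_metric_deriv_l x y alpha Uz) _.
  exact: (congr1 (fun r => - 2^-1 * (_ + r)) (third_swap23 oU sc _ _ _ Uz)).
- apply: etrans (cost_metric_deriv_l y x alpha Uz) _.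
  exact: (congr1 (fun r => - 2^-1 * (_ + r)) (etrans (third_swap13 _ _ _ Uz)
    (third_swap23 oU sc _ _ _ Uz))).
- exact: (congr1 (fun r => - 2^-1 * r) (f_equal2 (fun r s => r + s)
    (third_swap12 oU sc _ _ _ Uz) (third_swap12 oU sc _ _ _ Uz))).
Qed.

End levi_civita_cost.

(** Removes from the divergence the terms that do not depend on the variable being
    differentiated. *)
Lemma derive_subr_cst {R : realType} {V W : normedModType R} (f : V -> W) k x v :
  'D_v (fun y => f y - k) x = 'D_v f x.
Proof.
pose quot (h : V -> W) (t : R) := t^-1 *: ((h \o shift x) (t *: v) - h x).
suff E : quot (fun y => f y - k) = quot f.
  exact: (congr1 (fun q => lim (q @ 0^')) E).
by apply/funext => t; rewrite /quot /= opprB addrA subrK.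
Qed.

(** * The c-divergence, its metric and its symbols in charts *)

Section divergence.
Context {R : realType} {n : nat} {M M' : topologicalType}.
Variables (A : atlas R n M) (A' : atlas R n M') (c : M -> M' -> R).
Hypotheses (hA : smooth_atlas A) (hA' : smooth_atlas A').
Hypothesis c_smooth : smooth_cost A A' c.
Variables (phi : M -> R) (f : M -> M').
Hypotheses (phi_smooth : smooth_fun A setT phi) (f_grad : c_gradient c phi f).
Hypothesis f_smooth : smooth_map A A' setT f.
Variables (a : chart A) (b : chart A').

Local Notation cc := (cost_coord c a b).
Local Notation U := (cost_dom a b).
Let oU : open U := @cost_dom_open _ _ _ _ _ _ hA hA' a b.
Let sc : smooth U cc := @cost_coord_smooth _ _ _ _ _ _ _ c_smooth a b.
Local Notation L v := (row_mx v (0 : 'rV[R]_n) : 'rV[R]_(n + n)).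
Local Notation Rr v := (row_mx (0 : 'rV[R]_n) v : 'rV[R]_(n + n)).
Local Notation e_ i := (delta_mx 0 i : 'rV[R]_n).

Definition map_coord : 'rV[R]_n -> 'rV[R]_n := coord b \o f \o param a.
Definition map_dom : set 'rV[R]_n :=
  coord a @` (setT `&` dom a `&` f @^-1` dom b).

Local Notation F := map_coord.
Local Notation O := map_dom.
Let phih : 'rV[R]_n -> R := phi \o param a.

Lemma map_dom_open : open O.
Proof.
rewrite /map_dom setTI setIC; apply: (image_coord_open hA).
have [cf _] := f_smooth.
by apply: open_comp; [move=> x _; exact: cf|exact: (dom_open hA')].
Qed.

Lemma map_coord_smooth : smooth O F.
Proof. by have [_ sf] := f_smooth; exact: sf. Qed.

Lemma map_domP u : O u ->
  [/\ (coord a @` dom a) u, dom b (f (param a u)) &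
      param b (F u) = f (param a u)].
Proof.
move=> [p [[_ ap] bfp] <-]; split; first by exists p.
  by rewrite (chart_coordK hA).
by rewrite /F/= !(chart_coordK hA)// (chart_coordK hA').
Qed.

Lemma cost_dom_row s t : (coord a @` dom a) s -> O t -> U (row_mx s (F t)).
Proof.
move=> [p ap <-] /map_domP[_ bft _].
exact: (cost_dom_mem ap bft).
Qed.

Lemma phi_coord_differentiable s : (coord a @` dom a) s -> differentiable phih s.
Proof.
move=> as_; apply: (smooth_differentiable (phi_smooth a)).
by rewrite setTI.
Qed.

(** The equation defining [c_gradient] at q = f p excludes both infinite values of the c-transform
    and determines the finite one. *)
Lemma c_transform_map p : c_transform c phi (f p) = (c p (f p) - phi p)%:E.
Proof.
have /f_grad : f p = f p by [].
case: (c_transform c phi (f p)) => [r| |] //=.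
by move=> [<-]; rewrite addrAC subrr add0r.
Qed.

Lemma c_gradient_min p p0 : c p0 (f p0) - phi p0 <= c p (f p0) - phi p.
Proof.
rewrite -lee_fin -c_transform_map; apply: ereal_inf_lbound.
by exists p.
Qed.

(** The c-transform along f in coordinates, as an explicit differentiable function. *)
Let Psi (t : 'rV[R]_n) : R := cc (row_mx t (F t)) - phih t.

Lemma div_coordE s t : O t ->
  div_coord c phi (f := f) a s t = cc (row_mx s (F t)) - phih s - Psi t.
Proof.
move=> Ot; have [at_ bft bF] := map_domP Ot.
rewrite /div_coord /c_divergence /= c_transform_map /= /Psi /cost_coord.
by rewrite !row_mxKl !row_mxKr bF.
Qed.

Lemma cost_coord_differentiable z : U z -> differentiable cc z.
Proof. exact: (smooth_differentiable sc). Qed.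

Lemma row_map_differentiable s t : O t ->
  differentiable (fun t => row_mx s (F t)) t /\
  forall v, 'D_v (fun t => row_mx s (F t)) t = Rr ('D_v F t).
Proof.
move=> Ot; have dF := smooth_differentiable map_coord_smooth Ot.
have d0 := differentiable_cst s t; split=> [|v].
  exact: differentiable_row_mx d0 dF.
by apply: etrans (derive_row_mx v d0 dF) _; rewrite derive_cst.
Qed.

Lemma graph_coord_differentiable t : O t ->
  differentiable (fun t => row_mx t (F t)) t /\
  forall v, 'D_v (fun t => row_mx t (F t)) t = row_mx v ('D_v F t).
Proof.
move=> Ot; have dF := smooth_differentiable map_coord_smooth Ot.
have di : differentiable (id : 'rV[R]_n -> _) t by apply: ex_diff.
split=> [|v]; first exact: differentiable_row_mx di dF.
by apply: etrans (derive_row_mx v di dF) _; rewrite derive_id.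
Qed.

Lemma Psi_differentiable t : O t -> differentiable Psi t.
Proof.
move=> Ot; have [at_ _ _] := map_domP Ot.
have [dr _] := graph_coord_differentiable Ot.
apply: differentiableB (phi_coord_differentiable at_).
exact: differentiable_comp dr (cost_coord_differentiable (cost_dom_row at_ Ot)).
Qed.

(** The last term does not involve s, so it disappears under any later derivative in the source
    variable. *)
Lemma partial_div_target s t j : (coord a @` dom a) s -> O t ->
  partial j (fun t => div_coord c phi (f := f) a s t) t =
  'D_(Rr ('D_(e_ j) F t)) cc (row_mx s (F t)) - 'D_(e_ j) Psi t.
Proof.
move=> as_ Ot; have [dr Dr] := row_map_differentiable s Ot.
have dcc := cost_coord_differentiable (cost_dom_row as_ Ot).
have dcr : differentiable (fun t => cc (row_mx s (F t))) t.
  exact: differentiable_comp dr dcc.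
have E : \forall t' \near t, div_coord c phi (f := f) a s t' =
    cc (row_mx s (F t')) - Psi t' - phih s.
  apply: filterS (open_nbhs_nbhs (conj map_dom_open Ot)) => t' Ot'.
  by apply: etrans (div_coordE s Ot') _; rewrite addrAC.
apply: etrans (near_eq_derive (e_ j) E) _.
apply: etrans (derive_subr_cst _ _ _ _) _.
apply: etrans (deriveB (diff_derivable dcr)
  (diff_derivable (Psi_differentiable Ot))) _.
apply: (congr1 (fun r => r - _)).
by apply: etrans (derive_comp (e_ j) dr dcc) _; rewrite Dr.
Qed.

Lemma partial_div_source s t k : (coord a @` dom a) s -> O t ->
  partial k (fun s => div_coord c phi (f := f) a s t) s =
  'D_(L (e_ k)) cc (row_mx s (F t)) - 'D_(e_ k) phih s.
Proof.
move=> as_ Ot; have dphi := phi_coord_differentiable as_.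
have dcc := cost_coord_differentiable (cost_dom_row as_ Ot).
have dl : differentiable (fun s => row_mx s (F t)) s.
  by apply: differentiable_row_mx (differentiable_cst _ _); apply: ex_diff.
have dcr : differentiable (fun s => cc (row_mx s (F t))) s.
  exact: differentiable_comp dl dcc.
have -> : (fun s => div_coord c phi (f := f) a s t) =
    (fun s => cc (row_mx s (F t)) - phih s - Psi t).
  by apply/funext => s'; exact: div_coordE.
apply: etrans (derive_subr_cst _ _ _ _) _.
apply: etrans (deriveB (diff_derivable dcr) (diff_derivable dphi)) _.
apply: (congr1 (fun r => r - _)).
exact: derive_row_mxl.
Qed.

Lemma div_metricE u i j : O u ->
  div_metric c phi (f := f) a u i j =
  - mixed c a b (row_mx u (F u)) (e_ i) ('D_(e_ j) F u).
Proof.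
move=> Ou; have [au _ _] := map_domP Ou.
rewrite /div_metric mxE; apply: (congr1 -%R).
have E : \forall s \near u,
    partial j (fun t => div_coord c phi (f := f) a s t) u =
    'D_(Rr ('D_(e_ j) F u)) cc (row_mx s (F u)) - 'D_(e_ j) Psi u.
  apply: filterS (open_nbhs_nbhs (conj (@codom_open _ _ _ _ hA a) au)) => s as_.
  exact: partial_div_target.
apply: etrans (near_eq_derive (e_ i) E) _.
apply: etrans (derive_subr_cst _ _ _ _) _.
exact: (derive_row_mxl ('D_(Rr ('D_(e_ j) F u)) cc)).
Qed.

(** Both source derivatives are taken with the target direction ['D_(e_ k) F u] frozen, so no second
    derivative of F appears, unlike in [dual_div_christoffelE]. *)
Lemma div_christoffelE u i j k : O u ->
  div_christoffel1 c phi (f := f) a u i j k =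
  - third cc (row_mx u (F u)) (L (e_ i)) (L (e_ j)) (Rr ('D_(e_ k) F u)).
Proof.
move=> Ou; have [au _ _] := map_domP Ou.
rewrite /div_christoffel1; apply: (congr1 -%R).
have nau s1 : (coord a @` dom a) s1 -> nbhs s1 (coord a @` dom a).
  by move=> as1; exact: (open_nbhs_nbhs (conj (@codom_open _ _ _ _ hA a) as1)).
have E : \forall s1 \near u, partial j (fun s =>
      partial k (fun t => div_coord c phi (f := f) a s t) u) s1 =
    'D_(L (e_ j)) ('D_(Rr ('D_(e_ k) F u)) cc) (row_mx s1 (F u)).
  apply: filterS (nau _ au) => s1 as1.
  have E1 : \forall s \near s1,
      partial k (fun t => div_coord c phi (f := f) a s t) u =
      'D_(Rr ('D_(e_ k) F u)) cc (row_mx s (F u)) - 'D_(e_ k) Psi u.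
    by apply: filterS (nau _ as1) => s as_; exact: partial_div_target.
  apply: etrans (near_eq_derive (e_ j) E1) _.
  apply: etrans (derive_subr_cst _ _ _ _) _.
  exact: (derive_row_mxl ('D_(Rr ('D_(e_ k) F u)) cc)).
apply: etrans (near_eq_derive (e_ i) E) _.
exact: (derive_row_mxl ('D_(L (e_ j)) ('D_(Rr ('D_(e_ k) F u)) cc))).
Qed.

(** For fixed target t the divergence is minimal at the source s = t, by [c_gradient_min]; its
    source derivative vanishes there. *)
Lemma first_order_optimality t k : O t ->
  'D_(L (e_ k)) cc (row_mx t (F t)) = 'D_(e_ k) phih t.
Proof.
move=> Ot; have [at_ bft bF] := map_domP Ot.
apply/eqP; rewrite -subr_eq0 -(partial_div_source k at_ Ot); apply/eqP.
apply: (@derive_min _ _ _ (fun s => div_coord c phi (f := f) a s t) t (e_ k)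
  (@codom_open _ _ _ _ hA a) at_).
  move=> s as_; rewrite !div_coordE// lerD2r /cost_coord !row_mxKl !row_mxKr bF.
  exact: c_gradient_min.
move=> s as_.
have dcc := cost_coord_differentiable (cost_dom_row as_ Ot).
have dl : differentiable (fun s => row_mx s (F t)) s.
  by apply: differentiable_row_mx (differentiable_cst _ _); apply: ex_diff.
have -> : (fun s => div_coord c phi (f := f) a s t) =
    (fun s => cc (row_mx s (F t)) - phih s - Psi t).
  by apply/funext => s'; exact: div_coordE.
apply: differentiableB (differentiable_cst _ _).
apply: differentiableB (phi_coord_differentiable as_).
exact: differentiable_comp dl dcc.
Qed.

Lemma div_metric_sym u i j : O u ->
  mixed c a b (row_mx u (F u)) (e_ i) ('D_(e_ j) F u) =
  mixed c a b (row_mx u (F u)) (e_ j) ('D_(e_ i) F u).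
Proof.
move=> Ou; have [au _ _] := map_domP Ou.
have Uz := cost_dom_row au Ou; set z := row_mx u (F u).
(* The first-order condition differentiated along e_l. The Hessian of phi and the source block of
   the Hessian of c are symmetric, hence so is the remaining term. *)
have key k l : hess phih u (e_ l) (e_ k) =
    hess cc z (L (e_ l)) (L (e_ k)) + mixed c a b z (e_ k) ('D_(e_ l) F u).
  have E : \forall t \near u,
      'D_(e_ k) phih t = ('D_(L (e_ k)) cc \o (fun t => row_mx t (F t))) t.
    apply: filterS (open_nbhs_nbhs (conj map_dom_open Ou)) => t Ot.
    by rewrite -first_order_optimality.
  apply: etrans (near_eq_derive (e_ l) E) _.
  have [dr Dr] := graph_coord_differentiable Ou.
  have dcc : differentiable ('D_(L (e_ k)) cc) (row_mx u (F u)).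
    exact: (smooth_differentiable (smooth_derive _ sc) Uz).
  apply: etrans (derive_comp (e_ l) dr dcc) _.
  rewrite Dr.
  have := hess_linearl sc (L (e_ k)) Uz 1 (L (e_ l)) (Rr ('D_(e_ l) F u)).
  rewrite scale1r mul1r add_row_mx addr0 add0r => H.
  apply: etrans H _; apply: (congr1 (fun r => _ + r)).
  exact: (hessC oU sc _ _ Uz).
have S : hess phih u (e_ i) (e_ j) = hess phih u (e_ j) (e_ i).
  apply: (hessC (U := coord a @` (setT `&` dom a))).
  - exact: (image_coord_open hA openT).
  - exact: phi_smooth.
  - by rewrite setTI.
have C : hess cc z (L (e_ i)) (L (e_ j)) = hess cc z (L (e_ j)) (L (e_ i)).
  exact: (hessC oU sc _ _ Uz).
have K := etrans (esym (key i j)) (etrans (esym S) (key j i)).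
apply: (@addrI _ (hess cc z (L (e_ j)) (L (e_ i)))).
exact: (etrans K (congr1 (fun r => r + _) C)).
Qed.

(** After one target derivative both the base point (u, F t) and the direction ['D_(e_ j) F t]
    depend on t: the first yields the third derivative of the cost, the second the second derivative
    of F. *)
Lemma dual_div_christoffelE u i j k : O u ->
  dual_div_christoffel1 c phi (f := f) a u i j k =
  - (third cc (row_mx u (F u)) (Rr ('D_(e_ i) F u)) (Rr ('D_(e_ j) F u))
       (L (e_ k)) +
     mixed c a b (row_mx u (F u)) (e_ k) ('D_(e_ i) ('D_(e_ j) F) u)).
Proof.
move=> Ou; have [au _ _] := map_domP Ou.
have Uz := cost_dom_row au Ou.
rewrite /dual_div_christoffel1; apply: (congr1 -%R).
have nO t : O t -> nbhs t O.
  by move=> Ot; exact: (open_nbhs_nbhs (conj map_dom_open Ot)).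
have E : \forall t1 \near u, partial j (fun t =>
      partial k (fun s => div_coord c phi (f := f) a s t) u) t1 =
    mixed c a b (row_mx u (F t1)) (e_ k) ('D_(e_ j) F t1).
  apply: filterS (nO _ Ou) => t1 Ot1.
  have E1 : \forall t \near t1,
      partial k (fun s => div_coord c phi (f := f) a s t) u =
      'D_(L (e_ k)) cc (row_mx u (F t)) - 'D_(e_ k) phih u.
    by apply: filterS (nO _ Ot1) => t Ot; exact: partial_div_source.
  apply: etrans (near_eq_derive (e_ j) E1) _.
  apply: etrans (derive_subr_cst _ _ _ _) _.
  have [dr Dr] := row_map_differentiable u Ot1.
  have Uz1 := cost_dom_row au Ot1.
  have dcc : differentiable ('D_(L (e_ k)) cc) (row_mx u (F t1)).
    exact: (smooth_differentiable (smooth_derive _ sc) Uz1).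
  apply: etrans (derive_comp (e_ j) dr dcc) _; rewrite Dr.
  exact: (hessC oU sc _ _ Uz1).
apply: etrans (near_eq_derive (e_ i) E) _.
have [dr Dr] := row_map_differentiable u Ou.
have dDF : differentiable ('D_(e_ j) F) u.
  exact: (smooth_differentiable (smooth_derive _ map_coord_smooth) Ou).
have dk := differentiable_cst (e_ k) u.
have OU t : O t -> U (row_mx u (F t)) by exact: cost_dom_row.
have Dk : 'D_(e_ i) (cst (e_ k)) u = 0 by exact: derive_cst.
apply: etrans (derive_mixed hA hA' c_smooth map_dom_open Ou OU dr dk dDF
  (Dr (e_ i)) Dk erefl) _.
apply: (f_equal2 (fun r s => r + s)).
  exact: (third_swap23 oU sc _ _ _ Uz).
by apply: etrans (congr1 (fun r => r + _) (mixed0l c_smooth _ Uz)) (add0r _).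
Qed.

End divergence.

(** * Directional derivatives along a moving direction *)

Section directional.
Context {R : realType} {m : nat} {W : normedModType R}.
Variables (O : set 'rV[R]_m) (F : 'rV[R]_m -> W) (u : 'rV[R]_m).
Hypotheses (oO : open O) (sF : smooth O F) (Ou : O u).

Lemma differentiable_dir (Y : 'rV[R]_m -> 'rV[R]_m) :
  differentiable Y u -> differentiable (fun t => 'D_(Y t) F t) u.
Proof.
move=> dY.
apply: (@near_eq_differentiable _ _ _
    (\sum_(j < m) (fun t => Y t 0 j *: 'D_(delta_mx 0 j) F t))).
  apply: (open_in_near oO Ou) => t Ot; have dF := smooth_differentiable sF Ot.
  rewrite fct_sumE deriveE// diff_rV; apply: eq_bigr => j _.
  by rewrite deriveE.
apply: differentiable_sum => j.
have dDF := smooth_differentiable (smooth_derive (delta_mx 0 j) sF) Ou.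
by have [] := differentiable_scale (differentiable_coordf j dY) dDF.
Qed.

(** Expansion in the basis moves the varying direction into scalar coefficients, where the product
    rule applies. *)
Lemma derive_dir_expansion (Y : 'rV[R]_m -> 'rV[R]_m) v :
  differentiable Y u ->
  'D_v (fun t => 'D_(Y t) F t) u =
  \sum_(j < m) Y u 0 j *: 'D_v ('D_(delta_mx 0 j) F) u + 'D_('D_v Y u) F u.
Proof.
move=> dY; have dF t : O t -> differentiable F t by exact: smooth_differentiable.
have dDF j : differentiable ('D_(delta_mx 0 j) F) u.
  exact: (smooth_differentiable (smooth_derive _ sF) Ou).
have dYj j := differentiable_coordf j dY.
have E : \forall t \near u, 'D_(Y t) F t =
    \sum_(j < m) Y t 0 j *: 'D_(delta_mx 0 j) F t.
  apply: (open_in_near oO Ou) => t Ot.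
  rewrite deriveE; last exact: dF.
  rewrite diff_rV; apply: eq_bigr => j _; apply: (congr1 (fun w => _ *: w)).
  by rewrite deriveE//; exact: dF.
apply: etrans (near_eq_derive v E) _.
rewrite derive_sumE; last first.
  by move=> j; apply: diff_derivable; have [] := differentiable_scale (dYj j) (dDF j).
have -> : 'D_('D_v Y u) F u =
    \sum_(j < m) 'D_v Y u 0 j *: 'D_(delta_mx 0 j) F u.
  rewrite deriveE; last exact: dF.
  rewrite diff_rV; apply: eq_bigr => j _; apply: (congr1 (fun w => _ *: w)).
  by rewrite deriveE//; exact: dF.
rewrite -big_split; apply: eq_bigr => j _.
have [_ ->] := differentiable_scale (dYj j) (dDF j).
by rewrite derive_coordf.
Qed.

Lemma derive_derive_expansion w v : 'D_v ('D_w F) u =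
  \sum_(j < m) w 0 j *: 'D_v ('D_(delta_mx 0 j) F) u.
Proof.
have := derive_dir_expansion v (differentiable_cst w u).
by rewrite derive_cst derive0 addr0.
Qed.

Lemma derive_dir (Y : 'rV[R]_m -> 'rV[R]_m) v : differentiable Y u ->
  'D_v (fun t => 'D_(Y t) F t) u = 'D_v ('D_(Y u) F) u + 'D_('D_v Y u) F u.
Proof.
by move=> dY; rewrite (derive_dir_expansion v dY) -derive_derive_expansion.
Qed.

Lemma derive_derive_linearr v : linear (fun w => 'D_v ('D_w F) u).
Proof.
move=> s w w'; rewrite !derive_derive_expansion scaler_sumr -big_split.
by apply: eq_bigr => j _; rewrite !mxE scalerDl scalerA.
Qed.

Lemma derive_derive_linearl w : linear (fun v => 'D_v ('D_w F) u).
Proof.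
have dDF : differentiable ('D_w F) u.
  exact: (smooth_differentiable (smooth_derive _ sF) Ou).
by move=> s v v'; rewrite !deriveE// linearP.
Qed.

Lemma derive_linearl : linear (fun v => 'D_v F u).
Proof.
have dF := smooth_differentiable sF Ou.
by move=> s v v'; rewrite !deriveE// linearP.
Qed.

End directional.

(** * The two connections as identities of vectors at one point *)

Section connection_algebra.
Context {R : realType} {n : nat} {M M' : topologicalType}.
Variables (A : atlas R n M) (A' : atlas R n M') (c : M -> M' -> R).
Hypotheses (hA : smooth_atlas A) (hA' : smooth_atlas A').
Hypothesis c_smooth : smooth_cost A A' c.
Variables (phi : M -> R) (f : M -> M').
Hypotheses (phi_smooth : smooth_fun A setT phi) (f_grad : c_gradient c phi f).
Hypothesis f_smooth : smooth_map A A' setT f.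
Variables (a : chart A) (b : chart A') (u : 'rV[R]_n).

Local Notation cc := (cost_coord c a b).
Local Notation U := (cost_dom a b).
Let oU : open U := @cost_dom_open _ _ _ _ _ _ hA hA' a b.
Let sc : smooth U cc := @cost_coord_smooth _ _ _ _ _ _ _ c_smooth a b.
Local Notation L v := (row_mx v (0 : 'rV[R]_n) : 'rV[R]_(n + n)).
Local Notation Rr v := (row_mx (0 : 'rV[R]_n) v : 'rV[R]_(n + n)).
Local Notation e_ i := (delta_mx 0 i : 'rV[R]_n).
Local Notation F := (map_coord f a b).
Local Notation O := (map_dom f a b).
Hypothesis Ou : O u.
Local Notation z := (row_mx u (F u)).
Local Notation g := (div_metric c phi (f := f) a u).
Let oO : open O := @map_dom_open _ _ _ _ _ _ hA hA' _ f_smooth a b.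
Let sF : smooth O F := @map_coord_smooth _ _ _ _ _ _ _ f_smooth a b.

Let au : (coord a @` dom a) u. Proof. by have [] := map_domP hA hA' Ou. Qed.
Let Uz : U z. Proof. exact: (cost_dom_row hA hA'). Qed.

Let mixed_l w := mixed_linearl c_smooth w Uz.
Let mixed_r v := mixed_linearr hA hA' c_smooth v Uz.

(** Lowering an index with g is pairing with d_k F through the mixed Hessian; this links g to the
    tested form of the Levi-Civita connection. *)
Lemma div_metric_row w k :
  (w *m g) 0 k = - mixed c a b z w ('D_(e_ k) F u).
Proof.
rewrite mxE (linear_expansion w (mixed_l _)) -sumrN.
apply: eq_bigr => i _; apply: etrans (congr1 (fun r => _ * r)
  (div_metricE hA hA' c_smooth phi_smooth f_grad f_smooth i k Ou)) _.
exact: mulrN.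
Qed.

Lemma mixed_derive_sym v w :
  mixed c a b z v ('D_w F u) = mixed c a b z w ('D_v F u).
Proof.
have lF := derive_linearl sF Ou.
pose B v w := mixed c a b z v ('D_w F u).
have Bl w' : linear_for *%R (B ^~ w') by exact: mixed_l.
have Br v' : linear_for *%R (B v').
  move=> s w1 w2.
  exact: (etrans (congr1 (mixed c a b z v') (lF s w1 w2)) (mixed_r v' s _ _)).
apply: etrans (bilinear_expansion Bl Br v w) _.
apply: etrans _ (esym (bilinear_expansion Bl Br w v)).
rewrite exchange_big; apply: eq_bigr => j _; apply: eq_bigr => i _.
rewrite (mulrC (v 0 i)); apply: (congr1 (fun r => _ * r)).
exact: (div_metric_sym hA hA' c_smooth phi_smooth f_grad f_smooth).
Qed.

Let third1 v w := third_linear1 sc v w Uz.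
Let third2 v w := third_linear2 oU sc v w Uz.

(** A row in the last, lower index, so that raising it is right multiplication by the inverse of
    g. *)
Definition contract (G : 'I_n -> 'I_n -> 'I_n -> R) (v w : 'rV[R]_n) : 'rV[R]_n :=
  \row_k \sum_i \sum_j v 0 i * w 0 j * G i j k.

Lemma primal_christoffel_contract v w k :
  contract (div_christoffel1 c phi (f := f) a u) v w 0 k =
  - third cc z (L v) (L w) (Rr ('D_(e_ k) F u)).
Proof.
set r := Rr ('D_(e_ k) F u).
pose B v w := third cc z (L v) (L w) r.
have Bl w' : linear_for *%R (B ^~ w').
  move=> s v1 v2; exact: (etrans (congr1 (fun x => third cc z x (L w') r)
    (row_mxPl n s v1 v2)) (third1 (L w') r s (L v1) (L v2))).
have Br v' : linear_for *%R (B v').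
  move=> s w1 w2; exact: (etrans (congr1 (fun x => third cc z (L v') x r)
    (row_mxPl n s w1 w2)) (third2 (L v') r s (L w1) (L w2))).
rewrite mxE; apply: etrans _ (congr1 -%R (esym (bilinear_expansion Bl Br v w))).
rewrite -sumrN; apply: eq_bigr => i _; rewrite -sumrN; apply: eq_bigr => j _.
apply: etrans (congr1 (fun r => _ * r)
  (div_christoffelE hA hA' c_smooth phi_smooth f_grad f_smooth i j k Ou)) _.
exact: mulrN.
Qed.

Lemma dual_christoffel_contract v w k :
  contract (dual_div_christoffel1 c phi (f := f) a u) v w 0 k =
  - (third cc z (Rr ('D_v F u)) (Rr ('D_w F u)) (L (e_ k)) +
     mixed c a b z (e_ k) ('D_v ('D_w F) u)).
Proof.
have lF := derive_linearl sF Ou.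
pose B v w := third cc z (Rr ('D_v F u)) (Rr ('D_w F u)) (L (e_ k)).
have Rl s v1 v2 : Rr ('D_(s *: v1 + v2) F u) = s *: Rr ('D_v1 F u) + Rr ('D_v2 F u).
  exact: (etrans (congr1 (fun w => Rr w) (lF s v1 v2)) (row_mxPr n s _ _)).
have Bl w' : linear_for *%R (B ^~ w').
  move=> s v1 v2; exact: (etrans (congr1
    (fun x => third cc z x (Rr ('D_w' F u)) (L (e_ k))) (Rl s v1 v2)) (third1 (Rr ('D_w' F u)) (L (e_ k)) s _ _)).
have Br v' : linear_for *%R (B v').
  move=> s w1 w2; exact: (etrans (congr1
    (fun x => third cc z (Rr ('D_v' F u)) x (L (e_ k))) (Rl s w1 w2)) (third2 (Rr ('D_v' F u)) (L (e_ k)) s _ _)).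
pose B' v w := mixed c a b z (e_ k) ('D_v ('D_w F) u).
have Bl' w' : linear_for *%R (B' ^~ w').
  move=> s v1 v2; exact: (etrans (congr1 (mixed c a b z (e_ k))
    (derive_derive_linearl sF Ou w' s v1 v2)) (mixed_r (e_ k) s _ _)).
have Br' v' : linear_for *%R (B' v').
  move=> s w1 w2; exact: (etrans (congr1 (mixed c a b z (e_ k))
    (derive_derive_linearr oO sF Ou v' s w1 w2)) (mixed_r (e_ k) s _ _)).
rewrite mxE; apply: etrans _ (congr1 -%R (esym (f_equal2 (fun x y => x + y)
  (bilinear_expansion Bl Br v w) (bilinear_expansion Bl' Br' v w)))).
rewrite -big_split -sumrN; apply: eq_bigr => i _.
rewrite -big_split -sumrN; apply: eq_bigr => j _.
apply: etrans (congr1 (fun r => _ * r)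
  (dual_div_christoffelE hA hA' c_smooth phi_smooth f_grad f_smooth i j k Ou)) _.
by apply: etrans (mulrN _ _) _; apply: (congr1 -%R); exact: mulrDr.
Qed.

(** Here d stands for the derivative of the components of Y along v, and N for the M-block of the
    Levi-Civita derivative. Multiplied by g, the k-th entry of the claim is minus the hypothesis at
    beta = d_k F. *)
Lemma primal_vector d v y N : g \in unitmx ->
  (forall beta, mixed c a b z N beta =
     mixed c a b z d beta + third cc z (L v) (L y) (Rr beta)) ->
  d + contract (div_christoffel1 c phi (f := f) a u) v y *m invmx g = N.
Proof.
move=> gU HN; rewrite -[RHS](mulmxK gU) -[X in X + _](mulmxK gU) -mulmxDl.
apply: (congr1 (mulmx^~ (invmx g))); apply/rowP => k.
rewrite mxE !div_metric_row primal_christoffel_contract.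
by apply: etrans (esym (opprD _ _)) (congr1 -%R (esym (HN _))).
Qed.

(** N is now the M'-block, so it is compared with the image of the left vector under dF. Pairing
    that image with e_k gives, by symmetry of g, an entry of minus S g, in which the inverse of g
    has cancelled. *)
Lemma dual_vector d v y N : g \in unitmx -> mixed_hessian c a b u (F u) \in unitmx ->
  (forall alpha, mixed c a b z alpha N =
     mixed c a b z alpha ('D_v ('D_y F) u + 'D_d F u) +
     third cc z (Rr ('D_v F u)) (Rr ('D_y F u)) (L alpha)) ->
  'D_(d + contract (dual_div_christoffel1 c phi (f := f) a u) v y *m invmx g) F u = N.
Proof.
move=> gU CU HN; set gam := contract _ _ _; set S := d + _.
have Sg : S *m g = d *m g + gam by rewrite mulmxDl mulmxKV.
have key k : mixed c a b z (e_ k) ('D_S F u) = mixed c a b z (e_ k) N.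
  apply: etrans (mixed_derive_sym _ _) _.
  have := congr1 (fun r : 'rV[R]_n => - r 0 k) Sg.
  rewrite [in RHS]mxE !div_metric_row opprK opprD opprK => -> /=.
  rewrite (mixed_derive_sym d) dual_christoffel_contract opprK.
  apply: etrans _ (esym (HN _)).
  have -> := mixedDr hA hA' c_smooth (e_ k) ('D_v ('D_y F) u) ('D_d F u) Uz.
  move: (mixed _ _ _ _ _ _) (third _ _ _ _ _) (mixed _ _ _ _ _ _) => r1 r2 r3.
  by rewrite addrA addrAC [r3 + r1]addrC.
have [_ bu bF] := map_domP hA hA' Ou.
(* Nondegeneracy of the cost makes the pairings with all e_k determine a vector of the M'-block. *)
have CE w k : mixed c a b z (e_ k) w = (w *m (mixed_hessian c a b u (F u))^T) 0 k.
  rewrite mxE (linear_expansion w (mixed_r _)); apply: eq_bigr => j _.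
  by rewrite mxE mixed_hessianE.
have CU' : (mixed_hessian c a b u (F u))^T \in unitmx by rewrite unitmx_tr.
apply: (can_inj (mulmxK CU')); apply/rowP => k.
by rewrite -!CE.
Qed.

(** Makes the [invmx] in [raise_index] a true inverse: g factors through the mixed Hessian and the
    Jacobian of F, and G, the differential of f', will invert the latter. *)
Lemma div_metric_unit (G : {linear 'rV[R]_n -> 'rV[R]_n}) :
  mixed_hessian c a b u (F u) \in unitmx ->
  (forall v, G ('D_v F u) = v) -> g \in unitmx.
Proof.
move=> CU GF; pose J : 'M[R]_n := \matrix_(i, j) 'D_(e_ i) F u 0 j.
have JU : J \in unitmx.
  (* The i-th row of J is the image of e_i under dF, so the composition with G gives the identity
     matrix. *)
  suff /mulmx1_unit[] : J *m lin1_mx G = 1%:M by [].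
  apply/row_matrixP => i; rewrite row_mul mul_rV_lin1 row1.
  rewrite -[RHS]GF; apply: (congr1 G).
  by apply/rowP => j; rewrite !mxE.
have -> : g = - (mixed_hessian c a b u (F u) *m J^T).
  apply/matrixP => i j; rewrite [RHS]mxE.
  apply: etrans (div_metricE hA hA' c_smooth phi_smooth f_grad f_smooth i j Ou) _.
  apply: (congr1 -%R); rewrite mxE (linear_expansion _ (mixed_r _)).
  apply: eq_bigr => k _; rewrite mulrC; apply: (f_equal2 (fun r s => r * s)).
    exact: (esym (mixed_hessianE c a b u (F u) i k)).
  by rewrite !mxE.
by rewrite -scaleN1r unitmxZ ?unitrN1// unitmx_mul CU unitmx_tr.
Qed.

End connection_algebra.

Section christoffel.
Context {R : realType} {n : nat} {M M' : topologicalType}.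
Variables (A : atlas R n M) (c : M -> M' -> R) (phi : M -> R) (f : M -> M').
Local Notation AG := (graph_atlas A f).

Lemma connection_of_christoffelE (G : chart AG -> 'rV[R]_n -> 'I_n -> 'I_n -> 'I_n -> R)
    (V : set (graph_set f)) (X Y : vfield AG) a x :
  vector_field V Y -> V x -> dom a x ->
  connection_of_christoffel (raise_index c phi (f := f) G) X Y a x =
  'D_(X a x) (Y a \o param a) (coord a x) +
  contract (G a (coord a x)) (X a x) (Y a x) *m
    invmx (div_metric c phi (f := f) a (coord a x)).
Proof.
move=> vY Vx ax; set u := coord a x; set v := X a x; set y := Y a x.
have dY : differentiable (Y a \o param a) u.
  by apply: (smooth_differentiable (vY.2 a)); exists x.
apply/rowP => k; rewrite /connection_of_christoffel !mxE.
under eq_bigr do rewrite mulrDr; rewrite big_split; apply: (f_equal2 (fun r s => r + s)).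
  rewrite -(derive_coordf k v dY) deriveE; last exact: differentiable_coordf.
  rewrite diff_rV; apply: eq_bigr => i _; apply: (congr1 (fun r => _ * r)).
  by apply: deriveE; exact: differentiable_coordf.
rewrite -/u -/v -/y.
under [RHS]eq_bigr do rewrite mxE mulr_suml.
rewrite exchange_big; apply: eq_bigr => i _ /=.
under [RHS]eq_bigr do rewrite mulr_suml.
rewrite exchange_big mulr_sumr; apply: eq_bigr => j _ /=.
rewrite /raise_index mulr_suml mulr_sumr; apply: eq_bigr => m _.
by rewrite mulrCA mulrC -!mulrA; congr (_ * _); rewrite mulrC -mulrA.
Qed.
End christoffel.

(** * Fields extending tangent fields of the graph *)

Section graph_extension.
Context {R : realType} {n : nat} {M M' : topologicalType}.
Variables (A : atlas R n M) (A' : atlas R n M').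
Hypotheses (hA : smooth_atlas A) (hA' : smooth_atlas A').
Variables (f : M -> M').
Hypothesis f_smooth : smooth_map A A' setT f.
Variables (a : chart A) (b : chart A').
Local Notation F := (map_coord f a b).
Local Notation O := (map_dom f a b).
Local Notation AG := (graph_atlas A f).
Local Notation AP := (prod_atlas A A').
Local Notation ab := ((a, b) : chart AP).
Let cf : continuous f. Proof. by have [cf _] := f_smooth => p; exact: cf. Qed.
Let hAP : smooth_atlas AP := smooth_atlas_prod hA hA'.
Let hAG : smooth_atlas AG := smooth_atlas_graph hA cf.
Let oO : open O := @map_dom_open _ _ _ _ _ _ hA hA' _ f_smooth a b.
Let sF : smooth O F := @map_coord_smooth _ _ _ _ _ _ _ f_smooth a b.

Lemma map_dom_mem p : dom a p -> dom b (f p) -> O (coord a p).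
Proof. by move=> ap bp; exists p. Qed.

Lemma coord_graph p : dom a p -> dom b (f p) ->
  coord ab (p, f p) = row_mx (coord a p) (F (coord a p)).
Proof. by move=> ap bp; rewrite /map_coord /= (chart_coordK hA). Qed.

(** In charts the inclusion of the graph is t |-> (t, F t) near the point considered. *)
Lemma set_val_differentiable p : dom a p -> dom b (f p) ->
  differentiable (coord ab \o (set_val : graph_set f -> M * M') \o param (a := AG) a)
    (coord a p) /\
  forall v, pushforward (A1 := AG) (A2 := AP) set_val a ab (graph_point f p) v =
    row_mx v ('D_v F (coord a p)).
Proof.
move=> ap bp; have Ou := map_dom_mem ap bp.
have [dG DG] := graph_coord_differentiable f_smooth Ou.
have E : \forall t \near coord a p, row_mx t (F t) =
    (coord ab \o (set_val : graph_set f -> M * M') \o param (a := AG) a) t.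
  apply: filterS (near_image_coord hA (U := setT) openT (I : setT p) ap).
  by move=> t [tK _ _]; rewrite /= /map_coord /= tK.
split=> [|v]; first exact: near_eq_differentiable E dG.
rewrite /pushforward -(near_eq_diff E dG) -deriveE//; exact: DG.
Qed.

Variables (V : set (graph_set f)) (W : set (M * M')).
Hypotheses (oV : open V) (oW : open W).

Lemma vf_extends_value (X : vfield AG) (Xt : vfield AP) p :
  vf_extends V W X Xt -> V (graph_point f p) -> W (p, f p) ->
  dom a p -> dom b (f p) ->
  Xt ab (p, f p) = row_mx (X a (graph_point f p))
    ('D_(X a (graph_point f p)) F (coord a p)).
Proof.
move=> [_ ext] Vp Wp ap bp.
have [_ P] := set_val_differentiable ap bp.
apply: etrans (ext (graph_point f p) Vp Wp a ab ap (conj ap bp)) _.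
exact: P.
Qed.

(** Yt is prescribed on the graph only, but Xt is tangent to it there, so the derivative only sees
    prescribed values; this is why the choice of extensions does not matter. *)
Lemma vf_extends_dir (X Y : vfield AG) (Xt Yt : vfield AP) p :
  vf_extends V W X Xt -> vf_extends V W Y Yt ->
  vector_field V Y ->
  V (graph_point f p) -> W (p, f p) -> dom a p -> dom b (f p) ->
  let u := coord a p in
  let v := X a (graph_point f p) in
  let d := 'D_v (Y a \o param (a := AG) a) u in
  dir Xt Yt ab (p, f p) =
  row_mx d ('D_v ('D_(Y a (graph_point f p)) F) u + 'D_d F u).
Proof.
move=> eX eY vY Vp Wp ap bp u v d.
have Ou := map_dom_mem ap bp.
have [dG DG] := graph_coord_differentiable f_smooth Ou.
have dY : differentiable (Y a \o param (a := AG) a) u.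
  by apply: (smooth_differentiable (vY.2 a)); exists (graph_point f p).
have dF : differentiable F u := smooth_differentiable sF Ou.
have abp : dom ab (p, f p) by [].
have Yu : (Y a \o param (a := AG) a) u = Y a (graph_point f p).
  by rewrite /= (chart_coordK hA).
apply: etrans (dirE Xt eY.1 Wp abp) _.
rewrite (vf_extends_value eX)//.
have cG := coord_graph ap bp.
have dYt : differentiable (Yt ab \o param ab) (row_mx u (F u)).
  rewrite -cG; apply: (smooth_differentiable (eY.1.2 ab)).
  exact: image_coord_mem.
have E : \forall t \near u, ((Yt ab \o param ab) \o (fun t => row_mx t (F t))) t =
    row_mx ((Y a \o param (a := AG) a) t)
      ('D_((Y a \o param (a := AG) a) t) F t).
  (* On V' the graph stays inside the domains of both fields and of the chart b, so Yt is known
     along it. *)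
  pose V' := V `&` set_val @^-1` (W `&` snd @^-1` dom b).
  have oV' : open V'.
    apply: openI => //; apply: open_comp; first by move=> y _; exact: set_val_continuous.
    apply: openI => //; apply: open_comp; first by move=> y _; exact: cvg_snd.
    exact: dom_open.
  have V'p : V' (graph_point f p) by [].
  have nV := near_image_coord hAG (a := a) oV' V'p ap.
  apply: filterS nV => t [tK at_ [Vt [Wt bt]]].
  have bF : param b (F t) = f (param a t) by rewrite /map_coord /= (chart_coordK hA').
  have H := vf_extends_value eY Vt Wt at_ bt.
  rewrite /= row_mxKl row_mxKr bF; apply: etrans H _.
  exact: (congr1 (fun s => row_mx (Y a (graph_point f (param a t)))
    ('D_(Y a (graph_point f (param a t))) F s)) tK).
have DF := differentiable_dir oO sF Ou dY.
(* The direction (v, dF v) is the derivative of t |-> (t, F t) along v; the chain rule read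
   backwards gives the derivative of Yt along the graph. *)
apply: etrans (f_equal2 (fun w s => 'D_w (Yt ab \o param ab) s)
  (esym (DG v)) cG) _.
apply: etrans (esym (derive_comp v dG dYt)) _.
apply: etrans (near_eq_derive v E) _.
apply: etrans (derive_row_mx v dY DF) _.
apply: (congr1 (row_mx d)); apply: etrans (derive_dir oO sF Ou v dY) _.
by rewrite Yu.
Qed.

End graph_extension.

(** * Differentials of the two projections *)

Section projections.
Context {R : realType} {n : nat} {M M' : topologicalType}.
Variables (A : atlas R n M) (A' : atlas R n M').
Hypotheses (hA : smooth_atlas A) (hA' : smooth_atlas A').
Variables (f : M -> M') (f' : M' -> M).
Hypothesis f_diffeo : diffeo_onto_range A A' f f'.
Local Notation AG := (graph_atlas A f).
Local Notation AP := (prod_atlas A A').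
Let hAP : smooth_atlas AP := smooth_atlas_prod hA hA'.

Lemma diff_lsubmx z (w : 'rV[R]_(n + n)) : 'd (@lsubmx R 1 n n) z w = lsubmx w.
Proof. by rewrite diff_lin//; exact: continuous_lsubmx. Qed.

Lemma diff_rsubmx z (w : 'rV[R]_(n + n)) : 'd (@rsubmx R 1 n n) z w = rsubmx w.
Proof. by rewrite diff_lin//; exact: continuous_rsubmx. Qed.

Lemma proj0_differentiable (a b : chart A) (b' : chart A') p q :
  dom a p -> dom b p ->
  differentiable (coord (a := AG) a \o graph_proj0 f \o param (a := AP) (b, b'))
    (coord (a := AP) (b, b') (p, q)).
Proof.
move=> ap bp.
have dl : differentiable (@lsubmx R 1 n n) (coord (a := AP) (b, b') (p, q)).
  exact: differentiable_lsubmx.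
have ds : differentiable (coord a \o param b)
    (lsubmx (coord (a := AP) (b, b') (p, q))).
  by rewrite row_mxKl; exact: (transition_differentiable hA).
exact: (differentiable_comp dl ds).
Qed.

Lemma pushforward_proj0 (a : chart A) (b : chart A') p q w : dom a p ->
  pushforward (A1 := AP) (A2 := AG) (graph_proj0 f) (a, b) a (p, q) w = lsubmx w.
Proof.
move=> ap.
have dl : differentiable (@lsubmx R 1 n n) (coord (a := AP) (a, b) (p, q)).
  exact: differentiable_lsubmx.
have ds : differentiable (coord a \o param a)
    (lsubmx (coord (a := AP) (a, b) (p, q))).
  by rewrite row_mxKl; exact: (transition_differentiable hA).
apply: etrans (congr1 (fun h => h w) (diff_comp dl ds)) _.
rewrite /= diff_lsubmx row_mxKl.
exact: (pushforward_id hA).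
Qed.

Lemma range_inverse p : f' (f p) = p.
Proof. by have [_ _ K _] := f_diffeo; exact: K. Qed.

Lemma inverse_differentiable (a : chart A) (b : chart A') p :
  dom a p -> dom b (f p) ->
  differentiable (coord a \o f' \o param b) (coord b (f p)).
Proof.
move=> ap bp; have [_ _ _ [_ /(_ b a) sf']] := f_diffeo.
apply: (smooth_differentiable sf'); exists (f p) => //; split; last first.
  by rewrite /preimage/= range_inverse.
by split=> //; exists p.
Qed.

Lemma proj1_differentiable (a b : chart A) (b' : chart A') p :
  dom a p -> dom b' (f p) ->
  differentiable (coord (a := AG) a \o graph_proj1 f f' \o param (a := AP) (b, b'))
    (coord (a := AP) (b, b') (p, f p)).
Proof.
move=> ap bp.
have dr : differentiable (@rsubmx R 1 n n) (coord (a := AP) (b, b') (p, f p)).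
  exact: differentiable_rsubmx.
have ds : differentiable (coord a \o f' \o param b')
    (rsubmx (coord (a := AP) (b, b') (p, f p))).
  by rewrite row_mxKr; exact: inverse_differentiable.
exact: (differentiable_comp dr ds).
Qed.

Lemma pushforward_proj1 (a : chart A) (b : chart A') p w :
  dom a p -> dom b (f p) ->
  pushforward (A1 := AP) (A2 := AG) (graph_proj1 f f') (a, b) a (p, f p) w =
  pushforward f' b a (f p) (rsubmx w).
Proof.
move=> ap bp.
have dr : differentiable (@rsubmx R 1 n n) (coord (a := AP) (a, b) (p, f p)).
  exact: differentiable_rsubmx.
have ds : differentiable (coord a \o f' \o param b)
    (rsubmx (coord (a := AP) (a, b) (p, f p))).
  by rewrite row_mxKr; exact: inverse_differentiable.
apply: etrans (congr1 (fun h => h w) (diff_comp dr ds)) _.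
by rewrite /= diff_rsubmx row_mxKr.
Qed.

Lemma pushforward_inverse (a : chart A) (b : chart A') p v :
  dom a p -> dom b (f p) ->
  pushforward f' b a (f p) ('D_v (map_coord f a b) (coord a p)) = v.
Proof.
move=> ap bp; have [f_smooth _ _ _] := f_diffeo.
have Ou := map_dom_mem (f := f) ap bp.
have dF := smooth_differentiable (map_coord_smooth f_smooth a b) Ou.
rewrite deriveE//.
have [cf _] := f_smooth.
have H := pushforward_comp hA hA' v ap bp (cf p I) dF (inverse_differentiable ap bp).
apply: etrans H _.
have -> : f' \o f = idfun by apply/funext => x; exact: range_inverse.
exact: (pushforward_id hA).
Qed.

(** [induced_connection] allows a product chart whose M-factor is unrelated to the chart of the
    graph; the transformation law of X replaces that factor by [a]. *)
Lemma pushforward_prod_chart (F : M * M' -> graph_set f) (X : vfield AP)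
    (W : set (M * M')) (a b1 : chart A) (b : chart A') x :
  vector_field W X -> W x -> dom a x.1 -> dom b1 x.1 -> dom b x.2 ->
  differentiable (coord (a := AG) a \o F \o param (a := AP) (b1, b))
    (coord (a := AP) (b1, b) x) ->
  pushforward (A1 := AP) (A2 := AG) F (b1, b) a x (X (b1, b) x) =
  pushforward (A1 := AP) (A2 := AG) F (a, b) a x (X (a, b) x).
Proof.
move=> [vX _] Wx ax b1x bx dF.
have abx : dom (a := AP) (a, b) x by [].
have bbx : dom (a := AP) (b1, b) x by [].
rewrite (vX (a, b) (b1, b) x Wx abx bbx).
apply: (pushforward_comp hAP hAP _ abx bbx _ _ dF); first exact: cvg_id.
exact: (transition_differentiable hAP abx bbx).
Qed.

End projections.

(** * The two equalities in adapted charts *)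

Section main.
Context {R : realType} {n : nat} {M M' : topologicalType}.
Variables (A : atlas R n M) (A' : atlas R n M') (c : M -> M' -> R).
Hypotheses (hA : smooth_atlas A) (hA' : smooth_atlas A').
Hypothesis c_smooth : smooth_cost A A' c.
Hypothesis c_nondeg : nondegenerate_cost A A' c.
Variables (phi : M -> R) (f : M -> M') (f' : M' -> M).
Hypotheses (phi_smooth : smooth_fun A setT phi) (f_grad : c_gradient c phi f).
Hypothesis f_diffeo : diffeo_onto_range A A' f f'.
Local Notation AG := (graph_atlas A f).
Local Notation AP := (prod_atlas A A').
Variable nabbar : vfield AP -> vfield AP -> vfield AP.
Hypothesis LC : levi_civita (cost_metric A A' c) nabbar.
Let f_smooth : smooth_map A A' setT f. Proof. by have [] := f_diffeo. Qed.

Variables (V : set (graph_set f)) (W : set (M * M')).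
Variables (X Y : vfield AG) (Xt Yt : vfield AP).
Hypotheses (oV : open V) (oW : open W).
Hypothesis vY : vector_field V Y.
Hypotheses (eX : vf_extends V W X Xt) (eY : vf_extends V W Y Yt).
Variables (a : chart A) (b : chart A') (p : M).
Hypotheses (Vp : V (graph_point f p)) (Wp : W (p, f p)).
Hypotheses (ap : dom a p) (bp : dom b (f p)).

Local Notation F := (map_coord f a b).
Local Notation u := (coord a p).
Local Notation N := (nabbar Xt Yt (a, b) (p, f p)).

Let Ou : map_dom f a b u := map_dom_mem ap bp.

Let CU : mixed_hessian c a b u (F u) \in unitmx.
Proof. by rewrite /map_coord /= (chart_coordK hA)//; exact: c_nondeg. Qed.

Let gU : div_metric c phi (f := f) a u \in unitmx.
Proof.
apply: (div_metric_unit hA hA' c_smooth phi_smooth f_grad f_smooth Ou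
  (G := 'd (coord a \o f' \o param b) (coord b (f p))) CU) => v.
exact: (pushforward_inverse hA hA' f_diffeo).
Qed.

Lemma primal_connection_chart :
  primal_connection A c phi f X Y a (graph_point f p) = lsubmx N.
Proof.
apply: etrans (connection_of_christoffelE c phi _ X vY Vp ap) _.
apply: (primal_vector hA hA' c_smooth phi_smooth f_grad f_smooth Ou gU) => beta.
have := levi_civita_costl hA hA' c_smooth LC beta oW eX.1 eY.1 Wp ap bp.
rewrite (vf_extends_dir hA hA' f_smooth oV oW eX eY vY Vp Wp ap bp).
rewrite (vf_extends_value hA f_smooth eX Vp Wp ap bp).
rewrite (vf_extends_value hA f_smooth eY Vp Wp ap bp).
rewrite !row_mxKl (coord_graph hA ap bp); exact.
Qed.

Lemma dual_connection_chart :
  dual_connection A c phi f X Y a (graph_point f p) =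
  pushforward f' b a (f p) (rsubmx N).
Proof.
apply: etrans (connection_of_christoffelE c phi _ X vY Vp ap) _.
set S := _ + _.
(* The differential of f' undoes dF, so it suffices that dF maps the left vector to the M'-block of
   N. *)
have <- : 'D_S F u = rsubmx N.
  apply: (dual_vector hA hA' c_smooth phi_smooth f_grad f_smooth Ou gU CU) => alpha.
  have := levi_civita_costr hA hA' c_smooth LC alpha oW eX.1 eY.1 Wp ap bp.
  rewrite (vf_extends_dir hA hA' f_smooth oV oW eX eY vY Vp Wp ap bp).
  rewrite (vf_extends_value hA f_smooth eX Vp Wp ap bp).
  rewrite (vf_extends_value hA f_smooth eY Vp Wp ap bp).
  rewrite !row_mxKr (coord_graph hA ap bp); exact.
by rewrite (pushforward_inverse hA hA' f_diffeo).
Qed.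

End main.

(** * Existence of local extensions *)

Section extension.
Context {R : realType} {n : nat} {M M' : topologicalType}.
Variables (A : atlas R n M) (A' : atlas R n M').
Hypotheses (hA : smooth_atlas A) (hA' : smooth_atlas A').
Variables (f : M -> M') (f' : M' -> M).
Hypothesis f_diffeo : diffeo_onto_range A A' f f'.
Local Notation AG := (graph_atlas A f).
Local Notation AP := (prod_atlas A A').
Let f_smooth : smooth_map A A' setT f. Proof. by have [] := f_diffeo. Qed.
Let cf : continuous f. Proof. by have [cf _] := f_smooth => p; exact: cf. Qed.
Let hAP : smooth_atlas AP := smooth_atlas_prod hA hA'.
Let hAG : smooth_atlas AG := smooth_atlas_graph hA cf.
Variable V : set (graph_set f).
Hypothesis oV : open V.
Variables (a : chart A) (b : chart A').
Local Notation F := (map_coord f a b).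
Local Notation O := (map_dom f a b).
Let oO : open O := @map_dom_open _ _ _ _ _ _ hA hA' _ f_smooth a b.
Let sF : smooth O F := @map_coord_smooth _ _ _ _ _ _ _ f_smooth a b.

Definition extension_source : set M := dom a `&` graph_point f @^-1` V.
(** The points of [dom b] at whose preimage X can be read in the chart a, so that its pushforward by
    f is defined; f' is constrained on the range only. *)
Definition extension_target : set M' :=
  (range f `&` f' @^-1` extension_source) `&` dom b.
Definition extension_dom : set (M * M') :=
  fst @^-1` extension_source `&` snd @^-1` extension_target.

(* The second component is the pushforward f_* X. *)
Definition extension_coord (X : vfield AG) (w : 'rV[R]_(n + n)) : 'rV[R]_(n + n) :=
  let Xh t := X a (param (a := AG) a t) in
  let t := coord a (f' (param b (rsubmx w))) in
  row_mx (Xh (lsubmx w)) ('D_(Xh t) F t).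

Lemma extension_source_open : open extension_source.
Proof.
apply: openI; first exact: dom_open.
by apply: open_comp => // p _; exact: (continuous_graph_point cf).
Qed.

Lemma extension_target_open : open extension_target.
Proof.
apply: openI; last exact: dom_open.
have [_ orange _ [cf' _]] := f_diffeo.
exact: (open_setI_preimage orange cf' extension_source_open).
Qed.

Lemma extension_dom_open : open extension_dom.
Proof.
apply: openI; apply: open_comp.
- by move=> x _; exact: cvg_fst.
- exact: extension_source_open.
- by move=> x _; exact: cvg_snd.
- exact: extension_target_open.
Qed.

Lemma extension_dom_chart : extension_dom `<=` dom (a := AP) (a, b).
Proof. by move=> [p q] [[/= ap _] [_ /= bq]]. Qed.

Lemma extension_coord_smooth (X : vfield AG) : vector_field V X ->
  smooth (coord (a := AP) (a, b) @` extension_dom) (extension_coord X).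
Proof.
move=> vX; pose S := coord a @` extension_source.
set Q := _ @` _.
have oQ : open Q.
  have -> : Q = coord (a := AP) (a, b) @` (extension_dom `&` dom (a := AP) (a, b)).
    by rewrite (setIidl extension_dom_chart).
  exact: (image_coord_open hAP extension_dom_open).
pose Xh t := X a (param (a := AG) a t).
have sX : smooth S Xh.
  have := vX.2 a; rewrite image_coord_graph; apply: smooth_subset => t.
  by rewrite /S /extension_source setIC.
pose tau := coord a \o f' \o param b.
pose B := coord b @` (range f `&` dom b `&` f' @^-1` dom a).
have stau : smooth B tau.
  by have [_ _ _ [_ sf']] := f_diffeo; exact: sf'.
have Qr w : Q w -> B (rsubmx w).
  move=> [[p q] [_ [[rq [aq _]] bq]] <-] /=; rewrite row_mxKr.
  by exists q.
have Ql w : Q w -> S (lsubmx w).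
  by move=> [[p q] [sp _] <-] /=; rewrite row_mxKl; exists p.
have sr : smooth Q (fun w => tau (rsubmx w)).
  apply: (smooth_comp oQ Qr _ stau).
  by apply: (smooth_rsubmx oQ); exact: smooth_id.
have Qt w : Q w -> S (tau (rsubmx w)) /\ O (tau (rsubmx w)).
  move=> [[p q] [_ [[[p' _ pq] fq] bq]] <-] /=; rewrite row_mxKr /tau /=.
  rewrite (chart_coordK hA')//; split; first by exists (f' q).
  have [af' _] := fq; apply: map_dom_mem => //.
  by move: pq => /= pq; rewrite -pq (range_inverse f_diffeo) pq.
apply: (smooth_row_mx oQ).
  apply: (smooth_comp oQ Ql _ sX).
  by apply: (smooth_lsubmx oQ); exact: smooth_id.
(* The direction in the second block moves with w; smoothness is read off its expansion in fixed
   directions. *)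
apply: (@smooth_eq _ _ _ Q (fun w => \sum_(j < n)
   Xh (tau (rsubmx w)) 0 j *: 'D_(delta_mx 0 j) F (tau (rsubmx w)))) => //.
  move=> w /Qt[_ Ow]; have dF := smooth_differentiable sF Ow.
  apply: esym; apply: etrans (deriveE _ dF) _.
  rewrite diff_rV; apply: eq_bigr => j _; apply: (congr1 (fun r => _ *: r)).
  exact: (esym (deriveE _ dF)).
apply: smooth_sum => // j; apply: smoothZ => //.
  apply: (smooth_coordf (f := fun w => Xh (tau (rsubmx w)))) => //.
  by apply: (smooth_comp (g := Xh) oQ _ sr sX) => w /Qt[].
apply: (smooth_comp (g := 'D_(delta_mx 0 j) F) oQ _ sr (smooth_derive _ sF)).
by move=> w /Qt[].
Qed.

Lemma set_val_chart_differentiable (a1 b1 : chart A) (b2 : chart A') p :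
  dom a1 p -> dom b1 p -> dom b2 (f p) ->
  differentiable (coord (a := AP) (b1, b2) \o
    (set_val : graph_set f -> M * M') \o param (a := AG) a1) (coord a1 p).
Proof.
move=> a1p b1p b2p.
have d1 := transition_differentiable hA a1p b1p.
have d2 := smooth_differentiable (map_coord_smooth f_smooth a1 b2)
  (map_dom_mem a1p b2p).
exact: differentiable_row_mx d1 d2.
Qed.

(** In the chart (a, b) the value on the graph is the pushforward of X under the inclusion by
    construction; the chain rule carries this to all other charts of the graph and of the
    product. *)
Lemma vf_extends_chart_field (X : vfield AG) : vector_field V X ->
  vf_extends V extension_dom X
    (chart_field (A := AP) (a, b) (extension_coord X)).
Proof.
move=> vX; split.
  apply: (vector_field_chart_field hAP extension_dom_open extension_dom_chart).
  exact: extension_coord_smooth.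
move=> y; rewrite -(graph_pointK y); move: (set_val y).1 => p {y} Vy Wy.
move=> a1 [b1 b2] a1p [b1p b2p].
have [[ap _] [_ bp]] := Wy.
have [dS PS] := set_val_differentiable hA f_smooth ap bp.
have xE : extension_coord X (coord (a := AP) (a, b) (p, f p)) =
    pushforward (A1 := AG) (A2 := AP) set_val a (a, b) (graph_point f p)
      (X a (graph_point f p)).
  rewrite PS /extension_coord row_mxKl row_mxKr.
  rewrite (chart_coordK hA' bp) (range_inverse f_diffeo).
  have -> : param (a := AG) a (coord a p) = graph_point f p.
    exact: (chart_coordK hAG ap).
  by [].
apply: etrans (congr1 (fun v => pushforward (A1 := AP) (A2 := AP) idfun (a, b)
  (b1, b2) (p, f p) v) xE) _.
have csv : {for graph_point f p, continuous (set_val : graph_set f -> M * M')}.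
  exact: set_val_continuous.
have dT := transition_differentiable hAP (a := (a, b)) (b := (b1, b2))
  (conj ap bp) (conj b1p b2p).
have abp : dom (a := AP) (a, b) (set_val (graph_point f p)) by [].
have H1 := pushforward_comp hAG hAP (G := idfun) (X a (graph_point f p)) ap abp
  csv dS dT.
apply: etrans H1 _.
have -> : X a1 (graph_point f p) = _ := vX.1 a a1 (graph_point f p) Vy ap a1p.
apply: esym.
have dT' := transition_differentiable hAG (a := a) (b := a1)
  (p := graph_point f p) ap a1p.
exact: (pushforward_comp hAG hAG (F := idfun) (X a (graph_point f p)) ap a1p
  cvg_id dT'
  (set_val_chart_differentiable a1p b1p b2p)).
Qed.

End extension.

Theorem theorem3 (R : realType) (n : nat) (n_ge2 : (2 <= n)%N)
    (M M' : topologicalType) (A : atlas R n M) (A' : atlas R n M')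
    (mfdM : smooth_manifold A) (mfdM' : smooth_manifold A')
    (c : M -> M' -> R)
    (c_smooth : smooth_cost A A' c) (c_nondeg : nondegenerate_cost A A' c)
    (phi : M -> R)
    (phi_smooth : smooth_fun A setT phi) (phi_conc : c_concave c phi)
    (f : M -> M') (f' : M' -> M)
    (f_grad : c_gradient c phi f) (f_diffeo : diffeo_onto_range A A' f f')
    (nabbar : vfield (prod_atlas A A') -> vfield (prod_atlas A A') ->
              vfield (prod_atlas A A'))
    (nabbar_LC : levi_civita (cost_metric A A' c) nabbar) :
  induced_connection (graph_proj0 f)
    nabbar (primal_connection A c phi f) /\
  induced_connection (graph_proj1 f f')
    nabbar (dual_connection A c phi f).
Proof.
have [_ _ hA] := mfdM; have [_ _ hA'] := mfdM'.
have [f_smooth _ _ _] := f_diffeo.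
have exts (V : set (graph_set f)) (X Y : vfield (graph_atlas A f)) p :
    open V -> vector_field V X ->
    vector_field V Y -> V (graph_point f p) ->
    exists W (Xt Yt : vfield (prod_atlas A A')), [/\ open W, W (p, f p),
      vf_extends V W X Xt & vf_extends V W Y Yt].
  move=> oV vX vY Vp.
  have [+ _] := hA => /(_ p)[a ap]; have [+ _] := hA' => /(_ (f p))[b bp].
  exists (extension_dom f' V a b).
  exists (chart_field (A := prod_atlas A A') (a, b) (extension_coord f' a b X)).
  exists (chart_field (A := prod_atlas A A') (a, b) (extension_coord f' a b Y)).
  split; [| |exact: vf_extends_chart_field|exact: vf_extends_chart_field].
    exact: (extension_dom_open hA hA' f_diffeo oV).
  have fK := range_inverse f_diffeo p.
  by split=> //=; do 2!split=> //; rewrite /preimage/= fK.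
have vN W Xt Yt : open W -> vector_field W Xt -> vector_field W Yt ->
    vector_field W (nabbar Xt Yt).
  by have [aff _ _] := nabbar_LC; move=> oW; have [+ _ _ _ _] := aff W oW; exact.
(* Each point of the graph is written as [graph_point f p], so that both claims become statements at
   p. *)
split=> V X Y oV vX vY x; rewrite -(graph_pointK x); move: (set_val x).1 => p {x} Vp;
  (split; first exact: (exts V X Y p oV vX vY Vp));
  move=> W Xt Yt oW Wp eX eY a [b1 b] ap [b1p bp].
- have vNW := vN W Xt Yt oW eX.1 eY.1.
  apply: etrans (primal_connection_chart hA hA' c_smooth c_nondeg phi_smooth
    f_grad f_diffeo nabbar_LC oV oW vY eX eY Vp Wp ap bp) _.
  apply: etrans (esym (pushforward_proj0 hA f b (f p) _ ap)) _.
  (* The adapted chart (a, b) is exchanged for the prescribed chart (b1, b), which is legitimate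
     because [nabbar Xt Yt] is a vector field on W. *)
  apply: esym.
  exact: (pushforward_prod_chart hA hA' vNW Wp ap b1p bp
    (proj0_differentiable hA f b (f p) ap b1p)).
- have vNW := vN W Xt Yt oW eX.1 eY.1.
  apply: etrans (dual_connection_chart hA hA' c_smooth c_nondeg phi_smooth
    f_grad f_diffeo nabbar_LC oV oW vY eX eY Vp Wp ap bp) _.
  apply: etrans (esym (pushforward_proj1 f_diffeo _ ap bp)) _.
  apply: esym.
  exact: (pushforward_prod_chart hA hA' vNW Wp ap b1p bp
    (proj1_differentiable f_diffeo b1 ap bp)).
Qed.
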